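(* There is an isomorphism of $\mathfrak{sl}_2$-modules $$\mathcal A^\Gamma\cong\bigoplus_{k=0}^{\lfloor m/2\rfloor}\left(\operatorname{Res}^{S_m}_\Gamma S^{(m-k,k)}\right)^\Gamma\otimes V_{m-2k},$$ where $\mathcal A^\Gamma$ is the space of $\Gamma$-invariants of the graph algebra $\mathcal A$, $S^{(m-k,k)}$ is the Specht module (over $\mathbb C$) of $S_m$ for the partition $(m-k,k)$, and $\mathfrak{sl}_2$ acts on the right-hand side through the factors $V_{m-2k}$.
   Context: Let $n$ be the number of vertices, $m=\binom n2$, $[m]=\{1,\dots,m\}$, and identify $[m]$ with the set of $2$-element subsets of $\{1,\dots,n\}$ (edges of $K_n$) via the lexicographic order. Each $\pi\in S_n$ permutes edges by $\{i,j\}\mapsto\{\pi(i),\pi(j)\}$; this gives a homomorphism $\varphi:S_n\to S_m$, whose image $\Gamma=\varphi(S_n)\subseteq S_m$ is the pair group. The graph algebra is $\mathcal A=\mathbb C[x_1,\dots,x_m]/(x_1^2-x_1,\dots,x_m^2-x_m)$, with vector space basis $\boldsymbol{x}_S=\prod_{e\in S}x_e$, $S\subseteq[m]$; $S_m$, and hence $\Gamma$, acts linearly by $\gamma\cdot\boldsymbol{x}_S=\boldsymbol{x}_{\gamma(S)}$. Linear operators: $D_+(\boldsymbol{x}_S)=\sum_{e\in[m]\setminus S}\boldsymbol{x}_{S\cup\{e\}}$, $D_-(\boldsymbol{x}_S)=\sum_{e\in S}\boldsymbol{x}_{S\setminus\{e\}}$, $D_0(\boldsymbol{x}_S)=-(m-2|S|)\boldsymbol{x}_S$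 (empty sums are zero). They make $\mathcal A$ an $\mathfrak{sl}_2$-module via $e_\pm\mapsto D_\pm$, $h\mapsto D_0$, where $\mathfrak{sl}_2=\mathfrak{sl}_2(\mathbb C)$ has basis $e_+,e_-,h$ with $[h,e_\pm]=\pm2e_\pm$, $[e_+,e_-]=h$. These operators commute with $\Gamma$, so $\mathcal A^\Gamma$ is an $\mathfrak{sl}_2$-submodule. $\operatorname{Res}^{S_m}_\Gamma$ is restriction of the action to $\Gamma$, and $W^\Gamma$ denotes the $\Gamma$-fixed vectors of $W$. $V_d$ is the irreducible $\mathfrak{sl}_2$-module of dimension $d+1$, with basis $v_0,\dots,v_d$ and action $e_+v_i=(d-i)v_{i+1}$, $hv_i=(2i-d)v_i$, $e_-v_i=iv_{i-1}$ (with $v_{-1}=v_{d+1}=0$). *)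

(* Defs.v *)
From HB Require Import structures.
From mathcomp Require Import all_boot all_order all_algebra all_fingroup.
From mathcomp Require Import ring_quotient generic_quotient.
From mathcomp Require Import boolp reals complex.
From mathcomp Require Import mpoly ring.

Set Implicit Arguments.
Unset Strict Implicit.
Unset Printing Implicit Defensive.

Import GRing.Theory.

Local Open Scope ring_scope.

Section Pairs.
Variable n : nat.
Local Notation m := 'C(n, 2).

(* All two-element subsets of 'I_n, listed in lexicographic order of the pairs
   (i, j) with i < j; see mem_edges, edges_uniq and size_edges. *)
Definition edges : seq {set 'I_n} :=
  [seq [set p.1; p.2] | p : 'I_n * 'I_n <-
      [seq (i, j) | i <- enum 'I_n, j <- enum 'I_n] & (p.1 < p.2)%N].

Lemma mem_edges (e : {set 'I_n}) : (e \in edges) = (#|e| == 2).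
Proof.
apply/mapP/cards2P => [[[i j] ij ->]|[x [y [xy ->]]]].
  move: ij; rewrite mem_filter /= => /andP[ij _]; exists i, j; split => //.
  by apply: contraTneq ij => ->; rewrite ltnn.
have /orP[h|h] : ((x < y) || (y < x))%N by rewrite -neq_ltn (inj_eq val_inj).
  exists (x, y); rewrite // mem_filter /= h.
  by apply/allpairsP; exists (x, y); rewrite !mem_enum.
exists (y, x); last by rewrite setUC.
rewrite mem_filter /= h.
by apply/allpairsP; exists (y, x); rewrite !mem_enum.
Qed.

Lemma edges_uniq : uniq edges.
Proof.
rewrite map_inj_in_uniq.
  by rewrite filter_uniq // allpairs_uniq ?enum_uniq // => -[? ?] [? ?].
move=> [i j] [k l]; rewrite !mem_filter /= => /andP[ij _] /andP[kl _] eqs.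
have : i \in [set k; l] by rewrite -eqs set21.
have : j \in [set k; l] by rewrite -eqs set22.
rewrite !inE => /orP[]/eqP ? /orP[]/eqP ?; subst => //.
- by rewrite ltnn in ij.
- by have := ltn_trans ij kl; rewrite ltnn.
- by rewrite ltnn in ij.
Qed.

Lemma size_edges : size edges = m.
Proof.
rewrite -[n in RHS]card_ord -card_draws -(card_uniqP edges_uniq).
by apply: eq_card => e; rewrite mem_edges !inE.
Qed.

Definition edge (e : 'I_m) : {set 'I_n} := nth set0 edges e.

Lemma edge_inj : injective edge.
Proof.
move=> e f /eqP; rewrite nth_uniq ?size_edges ?edges_uniq //.
by move/eqP/val_inj.
Qed.

Lemma card_edge e : #|edge e| = 2.
Proof. by apply/eqP; rewrite -mem_edges mem_nth // size_edges. Qed.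

Lemma edge_surj (s : {set 'I_n}) : #|s| = 2 -> exists e, edge e = s.
Proof.
move=> /eqP; rewrite -mem_edges => se.
have h : (index s edges < m)%N by rewrite -size_edges index_mem.
by exists (Ordinal h); rewrite /edge nth_index.
Qed.

(* The default value e is never used: see edge_mapE. *)
Definition edge_map (p : 'S_n) (e : 'I_m) : 'I_m :=
  odflt e [pick f | edge f == p @: edge e].

Lemma edge_mapE p e : edge (edge_map p e) = p @: edge e.
Proof.
rewrite /edge_map; case: pickP => [f /eqP //|/= h].
have [|f /eqP] := @edge_surj (p @: edge e); last by rewrite h.
by rewrite card_imset ?card_edge //; apply: perm_inj.
Qed.

Lemma edge_map_inj p : injective (edge_map p).
Proof.
move=> e f /(congr1 edge); rewrite !edge_mapE => /imset_inj h.
by apply: edge_inj; apply: h; apply: perm_inj.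
Qed.

Definition edge_perm (p : 'S_n) : 'S_m := perm (@edge_map_inj p).

Lemma edge_permE p e : edge (edge_perm p e) = p @: edge e.
Proof. by rewrite permE edge_mapE. Qed.

(* The product p * q in 'S_n is "p, then q", so this says that edge_perm is a
   group homomorphism. *)
Lemma edge_permM :
  {in [set: 'S_n] &, {morph edge_perm : p q / p * q >-> p * q}}%g.
Proof.
move=> p q _ _; apply/permP => e; apply: edge_inj.
rewrite permM !edge_permE -imset_comp; apply: eq_imset => i.
by rewrite /= permM.
Qed.

Canonical edge_perm_morphism := Morphism edge_permM.

Definition pair_group : {group 'S_m} := (edge_perm @* [set: 'S_n])%G.

End Pairs.

Section GraphAlgebra.
Variables (F : fieldType) (m : nat).

Definition idempotent_ideal : {pred {mpoly F[m]}} := fun p =>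
  `[< exists q : 'I_m -> {mpoly F[m]},
        p = \sum_(i < m) q i * ('X_i ^+ 2 - 'X_i) >].

Lemma mem_idempotent_ideal p : reflect
  (exists q : 'I_m -> {mpoly F[m]}, p = \sum_(i < m) q i * ('X_i ^+ 2 - 'X_i))
  (p \in idempotent_ideal).
Proof. exact: asboolP. Qed.

(* Evaluation at the 0/1-points separates the squarefree monomials modulo the
   ideal; this is only used to prove that the x_S are linearly independent. *)
Definition bool_pt (T : {set 'I_m}) : 'I_m -> F := fun i => (i \in T)%:R.

Lemma meval_ideal p T : p \in idempotent_ideal -> p.@[bool_pt T] = 0.
Proof.
move=> /mem_idempotent_ideal[q ->]; rewrite raddf_sum big1 //= => i _.
rewrite mevalM mevalB rmorphXn /= !mevalXU /bool_pt.
by case: (i \in T); rewrite ?expr1n ?expr0n /= subrr mulr0.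
Qed.

Lemma idempotent_ideal_closed : idealr_closed idempotent_ideal.
Proof.
split.
- apply/mem_idempotent_ideal; exists (fun _ => 0).
  by rewrite big1 // => i _; rewrite mul0r.
- apply/negP => /(@meval_ideal _ set0); rewrite meval1 => /eqP.
  by rewrite oner_eq0.
- move=> a u v /mem_idempotent_ideal[q ->] /mem_idempotent_ideal[r ->].
  apply/mem_idempotent_ideal; exists (fun i => a * q i + r i).
  rewrite mulr_sumr -big_split /=; apply: eq_bigr => i _.
  by rewrite mulrDl mulrA.
Qed.

HB.instance Definition _ :=
  isIdealr.Build {mpoly F[m]} idempotent_ideal idempotent_ideal_closed.

Definition galg := {ideal_quot idempotent_ideal}.
HB.instance Definition _ := GRing.ComNzRing.on galg.

Definition galg_pi (p : {mpoly F[m]}) : galg :=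
  \pi_({ideal_quot idempotent_ideal})%qT p.

Lemma galg_pi_morph : zmod_morphism galg_pi.
Proof. exact: raddfB. Qed.
Lemma galg_pi_monoid : monoid_morphism galg_pi.
Proof. by split; [exact: rmorph1|exact: rmorphM]. Qed.
HB.instance Definition _ := GRing.isZmodMorphism.Build _ _ galg_pi galg_pi_morph.
HB.instance Definition _ := GRing.isMonoidMorphism.Build _ _ galg_pi galg_pi_monoid.

Lemma galg_pi_surj (a : galg) : exists p, a = galg_pi p.
Proof. by exists (repr a); rewrite /galg_pi reprK. Qed.

Lemma galg_pi_eq p q : (galg_pi p == galg_pi q) = (p - q \in idempotent_ideal).
Proof. by rewrite Quotient.idealrBE. Qed.

Definition galg_scale (c : F) (a : galg) : galg := galg_pi c%:MP * a.

Fact galg_scaleA c d a : galg_scale c (galg_scale d a) = galg_scale (c * d) a.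
Proof. by rewrite /galg_scale mulrA -rmorphM /= -mpolyCM. Qed.
Fact galg_scale1 : left_id 1 galg_scale.
Proof. by move=> a; rewrite /galg_scale mpolyC1 rmorph1 mul1r. Qed.
Fact galg_scaleDr : right_distributive galg_scale +%R.
Proof. by move=> c a b; rewrite /galg_scale mulrDr. Qed.
Fact galg_scaleDl a : {morph galg_scale^~ a : c d / c + d}.
Proof. by move=> c d; rewrite /galg_scale mpolyCD rmorphD mulrDl. Qed.
Fact galg_scaleAl c (a b : galg) : galg_scale c (a * b) = galg_scale c a * b.
Proof. exact: mulrA. Qed.

HB.instance Definition _ := GRing.Zmodule_isLmodule.Build F galg
  galg_scaleA galg_scale1 galg_scaleDr galg_scaleDl.
HB.instance Definition _ := GRing.Lmodule_isLalgebra.Build F galg galg_scaleAl.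

Definition gvar (e : 'I_m) : galg := galg_pi 'X_e.
Definition gmon (S : {set 'I_m}) : galg := \prod_(e in S) gvar e.

Lemma gvar_idem e : gvar e ^+ 2 = gvar e.
Proof.
apply/eqP; rewrite /gvar -rmorphXn galg_pi_eq.
apply/mem_idempotent_ideal; exists (fun i => (i == e)%:R).
rewrite (bigD1 e) //= eqxx mul1r big1 ?addr0 // => i /negPf ->.
by rewrite mul0r.
Qed.

Lemma galg_piM u : galg_pi 'X_[u] = gmon [set i | u i != 0%N].
Proof.
rewrite mpolyXE_id rmorph_prod /gmon big_mkcond [RHS]big_mkcond /=.
apply: eq_bigr => i _; rewrite inE rmorphXn /= -/(gvar i).
case: (u i) => // k; rewrite /=; elim: k => // k IH.
by rewrite exprS IH -expr2 gvar_idem.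
Qed.

Lemma galg_pi_scale c p : galg_pi (c *: p) = c *: galg_pi p.
Proof. by rewrite -mul_mpolyC rmorphM. Qed.

Lemma gmon_span (a : galg) :
  exists c : {ffun {set 'I_m} -> F}, a == \sum_S c S *: gmon S.
Proof.
have [p ->] := galg_pi_surj a; elim/mpolyind: p => [|c u p _ _ [d /eqP IH]].
  by exists [ffun => 0]; rewrite rmorph0 big1 // => S _; rewrite ffunE scale0r.
exists [ffun S => (c *+ (S == [set i | u i != 0%N])) + d S].
rewrite rmorphD /= IH galg_pi_scale galg_piM.
under [X in _ == X]eq_bigr => S _ do rewrite ffunE scalerDl.
rewrite big_split /=; apply/eqP; congr (_ + _).
rewrite (bigD1 [set i | u i != 0%N]) //= eqxx mulr1n.
by rewrite big1 ?addr0 // => S /negPf ->; rewrite mulr0n scale0r.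
Qed.

Lemma gmon_free (c d : {ffun {set 'I_m} -> F}) :
  \sum_S c S *: gmon S = \sum_S d S *: gmon S -> c = d.
Proof.
pose lift (c : {ffun {set 'I_m} -> F}) : {mpoly F[m]} :=
  \sum_S c S *: \prod_(e in S) 'X_e.
have liftE f : galg_pi (lift f) = \sum_S f S *: gmon S.
  rewrite rmorph_sum; apply: eq_bigr => S _.
  by rewrite /= galg_pi_scale rmorph_prod.
have liftev f T : (lift f).@[bool_pt T] = \sum_(S : {set 'I_m} | S \subset T) f S.
  rewrite raddf_sum /= [RHS]big_mkcond; apply: eq_bigr => S _.
  rewrite mevalZ rmorph_prod /=.
  case: ifPn => [/subsetP sST|/subsetPn[e eS eT]].
    by rewrite big1 ?mulr1 // => e eS; rewrite mevalXU /bool_pt sST.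
  by rewrite (bigD1 e) //= mevalXU /bool_pt (negPf eT) mul0r mulr0.
rewrite -!liftE => /eqP; rewrite galg_pi_eq => h.
have {}h (T : {set 'I_m}) :
    \sum_(S : {set 'I_m} | S \subset T) c S =
    \sum_(S : {set 'I_m} | S \subset T) d S.
  by apply/eqP; rewrite -!liftev -subr_eq0 -mevalB meval_ideal.
apply/ffunP => S; have [k] := ubnP #|S|; elim: k S => // k IH S.
rewrite ltnS => leSk; have := h S.
rewrite (bigD1 S) //= [in RHS](bigD1 S) //= => hS.
rewrite (eq_bigr d) in hS; first exact: addIr hS.
move=> T /andP[sTS nTS]; apply: IH.
by apply: leq_trans leSk; apply: proper_card; rewrite properEneq nTS.
Qed.

(* The coordinates of a in the basis (x_S); they are unique by gmon_free. *)
Definition gcoord (a : galg) : {ffun {set 'I_m} -> F} := xchoose (gmon_span a).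

Lemma gcoordE a : a = \sum_S gcoord a S *: gmon S.
Proof. exact/eqP/(xchooseP (gmon_span a)). Qed.

Lemma gcoord_sum (c : {ffun {set 'I_m} -> F}) :
  gcoord (\sum_S c S *: gmon S) = c.
Proof. by apply: gmon_free; rewrite -gcoordE. Qed.

Lemma gcoordP k a b S : gcoord (k *: a + b) S = k * gcoord a S + gcoord b S.
Proof.
suff -> : gcoord (k *: a + b) = [ffun S => k * gcoord a S + gcoord b S].
  by rewrite ffunE.
apply: gmon_free; rewrite -gcoordE {1}[a]gcoordE {1}[b]gcoordE scaler_sumr.
by rewrite -big_split; apply: eq_bigr => T _; rewrite ffunE scalerDl scalerA.
Qed.

Lemma gcoord_gmon S T : gcoord (gmon S) T = (T == S)%:R.
Proof.
have -> : gmon S = \sum_T [ffun T => (T == S)%:R : F] T *: gmon T.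
  rewrite (bigD1 S) //= ffunE eqxx scale1r big1 ?addr0 // => U /negPf h.
  by rewrite ffunE h scale0r.
by rewrite gcoord_sum ffunE.
Qed.

Fact galg_vect : Vector.axiom #|{set 'I_m}| galg.
Proof.
exists (fun a => \row_i gcoord a (enum_val i)) => [k a b|].
  by apply/rowP => i; rewrite !mxE gcoordP.
exists (fun r : 'rV_ _ => \sum_S r 0 (enum_rank S) *: gmon S) => [a|r].
  rewrite [RHS]gcoordE; apply: eq_bigr => S _.
  by rewrite mxE enum_rankK.
apply/rowP => i; rewrite mxE.
have := gcoord_sum [ffun S => r 0 (enum_rank S)].
under eq_bigr do rewrite ffunE.
by move=> ->; rewrite ffunE enum_valK.
Qed.
HB.instance Definition _ := Lmodule_hasFinDim.Build F galg galg_vect.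

(* Linear extension of x_S |-> f S. *)
Definition glin_fun (f : {set 'I_m} -> galg) (a : galg) : galg :=
  \sum_S gcoord a S *: f S.

Lemma glin_is_linear f : linear (glin_fun f).
Proof.
move=> k a b; rewrite /glin_fun scaler_sumr -big_split; apply: eq_bigr => S _.
by rewrite gcoordP scalerDl scalerA.
Qed.
HB.instance Definition _ f :=
  GRing.isLinear.Build F galg galg _ (glin_fun f) (glin_is_linear f).

Definition glin (f : {set 'I_m} -> galg) : 'End(galg) := linfun (glin_fun f).

Lemma glinE f S : glin f (gmon S) = f S.
Proof.
rewrite lfunE /= /glin_fun (bigD1 S) //= gcoord_gmon eqxx scale1r.
by rewrite big1 ?addr0 // => T /negPf h; rewrite gcoord_gmon h scale0r.
Qed.

Lemma eq_gmon (f g : 'End(galg)) : (forall S, f (gmon S) = g (gmon S)) -> f = g.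
Proof.
move=> h; apply/lfunP => a; rewrite [a]gcoordE !linear_sum.
by apply: eq_bigr => S _; rewrite !linearZ /= h.
Qed.

Definition gact (s : 'S_m) : 'End(galg) := glin (fun S => gmon (s @: S)).

Definition gD_plus : 'End(galg) :=
  glin (fun S => \sum_(e | e \notin S) gmon (e |: S)).
Definition gD_minus : 'End(galg) :=
  glin (fun S => \sum_(e in S) gmon (S :\ e)).
Definition gD_zero : 'End(galg) :=
  glin (fun S => - (m%:R - 2%:R * #|S|%:R) *: gmon S).

End GraphAlgebra.

Section Invariants.
Variables (F : fieldType) (gT : finGroupType) (V : vectType F).

Definition invariants (act : gT -> 'End(V)) (G : {set gT}) (W : {vspace V}) :
  {vspace V} := (W :&: \bigcap_(g in G) fixedSpace (act g))%VS.

Lemma invariantsP (act : gT -> 'End(V)) (G : {set gT}) (W : {vspace V}) v :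
  reflect (v \in W /\ forall g, g \in G -> act g v = v)
          (v \in invariants act G W).
Proof.
rewrite memv_cap; apply: (iffP andP) => -[vW h]; split=> //.
  move=> g gG; apply/fixedSpaceP; move: v h {vW}; apply/subvP.
  by apply: (bigcapv_inf g).
have /subvP : (<[v]> <= \bigcap_(g in G) fixedSpace (act g))%VS.
  by apply/subv_bigcapP => g gG; rewrite -memvE; apply/fixedSpaceP/h.
by apply; rewrite memv_line.
Qed.

End Invariants.

Section Specht.
Variables (F : fieldType) (m : nat) (shape : seq nat).

(* The cells of the Young diagram are numbered 0, ..., m - 1 row by row, which
   is what reshape_index (row) and reshape_offset (column) decode, provided
   sumn shape = m. A tableau is a permutation t, with entry t p in cell p;
   row_of t a and col_of t a locate the entry a. Since t * s is the function
   s o t, the left action of s on tableaux is t |-> t * s. *)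
Definition cell_row (p : 'I_m) : nat := reshape_index shape p.
Definition cell_col (p : 'I_m) : nat := reshape_offset shape p.

Definition row_of (t : 'S_m) (a : 'I_m) : nat := cell_row ((t^-1)%g a).
Definition col_of (t : 'S_m) (a : 'I_m) : nat := cell_col ((t^-1)%g a).

(* Two tableaux are row equivalent when each entry lies in the same row in
   both; a tabloid is a row equivalence class. *)
Definition row_class (t : 'S_m) : {set 'S_m} :=
  [set u : 'S_m | [forall a, row_of u a == row_of t a]].

Definition tabloid := {T : {set 'S_m} | T \in codom row_class}.
HB.instance Definition _ := Finite.on tabloid.

Definition tabloid_of (t : 'S_m) : tabloid :=
  exist _ (row_class t) (codom_f row_class t).

Definition tabloid_repr (T : tabloid) : 'S_m := iinv (valP T).

Lemma tabloid_reprK : cancel tabloid_repr tabloid_of.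
Proof. by move=> T; apply: val_inj; rewrite /= f_iinv. Qed.

Lemma tabloid_eqP (t u : 'S_m) :
  reflect (forall a, row_of t a = row_of u a) (tabloid_of t == tabloid_of u).
Proof.
apply: (iffP eqP) => [/(congr1 val)/= /setP/(_ t)|h].
  rewrite !inE; have -> : [forall a, row_of t a == row_of t a] by apply/forallP.
  by move=> /esym/forallP h a; apply/eqP/h.
apply: val_inj; apply/setP => v; rewrite !inE; apply: eq_forallb => a.
by rewrite h.
Qed.

Definition tabloid_act (s : 'S_m) (T : tabloid) : tabloid :=
  tabloid_of (tabloid_repr T * s)%g.

Lemma row_ofM t s a : row_of (t * s)%g a = row_of t ((s^-1)%g a).
Proof. by rewrite /row_of invMg permM. Qed.

Lemma col_ofM t s a : col_of (t * s)%g a = col_of t ((s^-1)%g a).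
Proof. by rewrite /col_of invMg permM. Qed.

Lemma tabloid_actE s t : tabloid_act s (tabloid_of t) = tabloid_of (t * s)%g.
Proof.
apply/eqP/tabloid_eqP => a; rewrite !row_ofM.
by apply/tabloid_eqP; rewrite tabloid_reprK.
Qed.

Definition perm_module := {ffun tabloid -> F^o}.
HB.instance Definition _ := Vector.on perm_module.

Definition tabloid_vec (T : tabloid) : perm_module := [ffun U => (U == T)%:R].

Definition perm_module_fun (s : 'S_m) (f : perm_module) : perm_module :=
  \sum_T f T *: tabloid_vec (tabloid_act s T).

Fact perm_module_fun_linear s : linear (perm_module_fun s).
Proof.
move=> k f g; rewrite /perm_module_fun scaler_sumr -big_split.
by apply: eq_bigr => T _; rewrite !ffunE scalerDl scalerA.
Qed.
HB.instance Definition _ s := GRing.isLinear.Build F perm_module perm_module _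
  (perm_module_fun s) (perm_module_fun_linear s).

Definition perm_module_act (s : 'S_m) : 'End(perm_module) :=
  linfun (perm_module_fun s).

Lemma perm_module_actE s T :
  perm_module_act s (tabloid_vec T) = tabloid_vec (tabloid_act s T).
Proof.
rewrite lfunE /= /perm_module_fun (bigD1 T) //= ffunE eqxx scale1r.
by rewrite big1 ?addr0 // => U /negPf h; rewrite ffunE h scale0r.
Qed.

Definition col_stab (t : 'S_m) : {set 'S_m} :=
  [set s : 'S_m | [forall a, col_of t (s a) == col_of t a]].

Definition polytabloid (t : 'S_m) : perm_module :=
  \sum_(s in col_stab t) (-1) ^+ s *: tabloid_vec (tabloid_of (t * s)%g).

Definition specht : {vspace perm_module} := <<codom polytabloid>>%VS.

Lemma col_stabJ t s u : ((u ^ s)%g \in col_stab (t * s)%g) = (u \in col_stab t).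
Proof.
rewrite !inE; apply/forallP/forallP => h a.
  by have := h (s a); rewrite !col_ofM conjgE !permM !permK.
rewrite !col_ofM; have := h ((s^-1)%g a).
by rewrite conjgE !permM permK.
Qed.

Lemma polytabloid_act s t :
  perm_module_act s (polytabloid t) = polytabloid (t * s)%g.
Proof.
rewrite /polytabloid linear_sum [RHS](reindex_inj (conjg_inj s)) /=.
apply: eq_big => [u|u _]; first by rewrite col_stabJ.
rewrite linearZ /= perm_module_actE tabloid_actE odd_permJ.
by rewrite -!mulgA -conjgC.
Qed.

Lemma specht_stable s : (perm_module_act s @: specht <= specht)%VS.
Proof.
rewrite limg_span; apply/span_subvP => _ /mapP[_ /codomP[t ->] ->].
by rewrite polytabloid_act memv_span // codom_f.
Qed.

End Specht.

Section Tensor.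
Variables (F : fieldType) (V W : vectType F).

Definition tensor := 'M[F]_(\dim {:V}, \dim {:W}).
HB.instance Definition _ := Vector.on tensor.

(* Coordinate model of the tensor product: tens v w is the matrix of products
   of the coordinates of v and w in fixed bases. It is characterised by
   tensor_universal below. *)
Definition tens (v : V) (w : W) : tensor :=
  \matrix_(i, j) (coord (vbasis {:V}) i v * coord (vbasis {:W}) j w).

Lemma tensDl k (v v' : V) (w : W) :
  tens (k *: v + v') w = k *: tens v w + tens v' w.
Proof. by apply/matrixP => i j; rewrite !mxE linearP mulrDl mulrA. Qed.

Lemma tensDr k (v : V) (w w' : W) :
  tens v (k *: w + w') = k *: tens v w + tens v w'.
Proof. by apply/matrixP => i j; rewrite !mxE linearP mulrDr mulrCA. Qed.

Section Lift.
Variables (Z : vectType F) (b : V -> W -> Z).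

Definition tens_lift_fun (X : tensor) : Z :=
  \sum_i \sum_j X i j *: b (vbasis {:V})`_i (vbasis {:W})`_j.

Fact tens_lift_linear : linear tens_lift_fun.
Proof.
move=> k X Y; rewrite /tens_lift_fun scaler_sumr -big_split.
apply: eq_bigr => i _; rewrite /= scaler_sumr -big_split.
by apply: eq_bigr => j _; rewrite /= !mxE scalerDl scalerA.
Qed.
HB.instance Definition _ :=
  GRing.isLinear.Build F tensor Z _ tens_lift_fun tens_lift_linear.

Definition tens_lift : 'Hom(tensor, Z) := linfun tens_lift_fun.

Hypothesis bl : forall w, linear (b^~ w).
Hypothesis br : forall v, linear (b v).

Lemma tens_liftE v w : tens_lift (tens v w) = b v w.
Proof.
pose B1 w : {linear V -> Z} :=
  HB.pack (b^~ w) (GRing.isLinear.Build _ _ _ _ _ (bl w)).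
pose B2 v : {linear W -> Z} :=
  HB.pack (b v) (GRing.isLinear.Build _ _ _ _ _ (br v)).
rewrite lfunE /= /tens_lift_fun {2}(coord_vbasis (memvf v)).
rewrite -[RHS]/(B1 w _) linear_sum; apply: eq_bigr => i _.
rewrite linearZ /= {2}(coord_vbasis (memvf w)).
rewrite -[b _ _ in RHS]/(B2 _ _) linear_sum scaler_sumr; apply: eq_bigr => j _.
by rewrite linearZ /= scalerA mxE.
Qed.

End Lift.

Lemma tens_span (X : tensor) :
  X = \sum_i \sum_j X i j *: tens (vbasis {:V})`_i (vbasis {:W})`_j.
Proof.
rewrite {1}[X]matrix_sum_delta; apply: eq_bigr => i _; apply: eq_bigr => j _.
congr (_ *: _); apply/matrixP => k l.
rewrite !mxE !coord_free; try exact/basis_free/vbasisP.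
by rewrite -natrM mulnb (eq_sym i) (eq_sym j).
Qed.

Lemma eq_tens (Z : vectType F) (g h : 'Hom(tensor, Z)) :
  (forall v w, g (tens v w) = h (tens v w)) -> g = h.
Proof.
move=> gh; apply/lfunP => X; rewrite [X]tens_span !linear_sum.
apply: eq_bigr => i _; rewrite !linear_sum; apply: eq_bigr => j _.
by rewrite !linearZ /= gh.
Qed.

Lemma tensor_universal (Z : vectType F) (b : V -> W -> Z) :
  (forall w, linear (b^~ w)) -> (forall v, linear (b v)) ->
  exists! h : 'Hom(tensor, Z), forall v w, h (tens v w) = b v w.
Proof.
move=> bl br; exists (tens_lift b); split=> [v w|h hE]; first exact: tens_liftE.
by apply: eq_tens => v w; rewrite tens_liftE.
Qed.

Definition tens_map (f : 'End(V)) (g : 'End(W)) : 'End(tensor) :=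
  tens_lift (fun v w => tens (f v) (g w)).

Lemma tens_mapE f g v w : tens_map f g (tens v w) = tens (f v) (g w).
Proof.
by apply: tens_liftE => [u k v1 v2|u k w1 w2]; rewrite linearP ?tensDl ?tensDr.
Qed.

End Tensor.

Section Sl2.
Variable F : fieldType.

Definition lfun_comm (V : vectType F) (f g : 'End(V)) : 'End(V) :=
  (f \o g)%VF - (g \o f)%VF.

Lemma lfun_commE (V : vectType F) (f g : 'End(V)) v :
  lfun_comm f g v = f (g v) - g (f v).
Proof. by rewrite add_lfunE opp_lfunE !comp_lfunE. Qed.

(* Traceless 2 x 2 matrices, with the commutator as bracket. *)
Definition sl2_space : {vspace 'M[F]_2} :=
  lker (linfun (mxtrace : 'M[F]_2 -> F^o)).

Local Notation sl2 := (subvs_of sl2_space).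

Lemma mem_sl2 (x : 'M[F]_2) : (x \in sl2_space) = (\tr x == 0).
Proof. by rewrite memv_ker lfunE. Qed.

Definition sl2_bracket (x y : sl2) : sl2 :=
  vsproj sl2_space (vsval x *m vsval y - vsval y *m vsval x).

Lemma sl2_bracketE x y :
  vsval (sl2_bracket x y) = vsval x *m vsval y - vsval y *m vsval x.
Proof.
by rewrite /= vsprojK // mem_sl2 mxtraceD linearN /= mxtrace_mulC subrr.
Qed.

Definition sl2_e_plus : sl2 := vsproj sl2_space (delta_mx 0 1).
Definition sl2_e_minus : sl2 := vsproj sl2_space (delta_mx 1 0).
Definition sl2_h : sl2 := vsproj sl2_space (delta_mx 0 0 - delta_mx 1 1).

Lemma sl2_e_plusE : vsval sl2_e_plus = delta_mx 0 1.
Proof.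
by rewrite /= vsprojK // mem_sl2 /mxtrace !big_ord_recl big_ord0 !mxE addr0 addr0.
Qed.
Lemma sl2_e_minusE : vsval sl2_e_minus = delta_mx 1 0.
Proof.
by rewrite /= vsprojK // mem_sl2 /mxtrace !big_ord_recl big_ord0 !mxE addr0 addr0.
Qed.
Lemma sl2_hE : vsval sl2_h = delta_mx 0 0 - delta_mx 1 1.
Proof.
rewrite /= vsprojK // mem_sl2 /mxtrace !big_ord_recl big_ord0 !mxE /=.
by rewrite addr0 subr0 add0r subrr.
Qed.

Lemma sl2_relations :
  [/\ sl2_bracket sl2_h sl2_e_plus = 2%:R *: sl2_e_plus,
      sl2_bracket sl2_h sl2_e_minus = - 2%:R *: sl2_e_minus &
      sl2_bracket sl2_e_plus sl2_e_minus = sl2_h].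
Proof.
have two (P : 'I_2 -> Prop) : P 0 -> P 1 -> forall i, P i.
  move=> P0 P1 i; case: (unliftP 0 i) => [j|] ->; rewrite ?ord1 //.
  by rewrite (_ : lift _ _ = 1) //; apply: val_inj.
split; apply: val_inj; rewrite /= sl2_bracketE ?linearZ /= ?sl2_e_plusE ?sl2_e_minusE ?sl2_hE;
  apply/matrixP => i j; rewrite !mxE !big_ord_recl !big_ord0 !mxE;
  move: i j; apply: (two) => [|]; apply: (two); rewrite /=; ring.
Qed.

Record sl2Module := Sl2Module {
  sl2_carrier :> vectType F;
  sl2_rho : 'Hom(sl2, 'End(sl2_carrier));
  sl2_rhoP : forall x y, sl2_rho (sl2_bracket x y) =
    lfun_comm (sl2_rho x) (sl2_rho y)
}.

Definition sl2_isomorphic (M N : sl2Module) : Prop :=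
  exists f : 'Hom(M, N),
    bijective f /\ forall x v, f (sl2_rho M x v) = sl2_rho N x (f v).

Section Triple.
Variables (V : vectType F) (E H D : 'End(V)).
Hypothesis HE : lfun_comm H E = 2%:R *: E.
Hypothesis HD : lfun_comm H D = - 2%:R *: D.
Hypothesis ED : lfun_comm E D = H.

Definition sl2_triple_fun (x : sl2) : 'End(V) :=
  vsval x 0 1 *: E + vsval x 1 0 *: D + vsval x 0 0 *: H.

Fact sl2_triple_linear : linear sl2_triple_fun.
Proof.
move=> k x y; rewrite /sl2_triple_fun linearP /= !mxE !scalerDl !scalerDr !scalerA.
by rewrite (addrACA (_ *: E) _ (_ *: D)) [LHS]addrACA.
Qed.
HB.instance Definition _ := GRing.isLinear.Build F sl2 'End(V) _
  sl2_triple_fun sl2_triple_linear.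

Fact sl2_triple_rhoP x y : linfun sl2_triple_fun (sl2_bracket x y) =
  lfun_comm (linfun sl2_triple_fun x) (linfun sl2_triple_fun y).
Proof.
have trx (z : sl2) : vsval z 1 1 = - vsval z 0 0.
  have := subvsP z; rewrite mem_sl2 /mxtrace !big_ord_recl big_ord0 addr0.
  rewrite addrC addr_eq0 => /eqP <-; congr (vsval z _ _); exact: val_inj.
rewrite !lfunE /= /sl2_triple_fun sl2_bracketE !mxE !big_ord_recl !big_ord0.
have -> : lift ord0 ord0 = 1 :> 'I_2 by apply: val_inj.
have -> : ord0 = 0 :> 'I_2 by [].
rewrite !trx.
have HEv v : H (E v) = E (H v) + 2%:R *: E v.
  by rewrite -scale_lfunE -HE lfun_commE addrC subrK.
have HDv v : H (D v) = D (H v) - 2%:R *: D v.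
  by rewrite -scaleNr -scale_lfunE -HD lfun_commE addrC subrK.
have EDv v : E (D v) = D (E v) + H v.
  by rewrite -ED lfun_commE addrC subrK.
have eqc (u w : V) :
    (forall i, coord (vbasis {:V}) i u = coord (vbasis {:V}) i w) -> u = w.
  move=> uw; rewrite (coord_vbasis (memvf u)) (coord_vbasis (memvf w)).
  by apply: eq_bigr => i _; rewrite uw.
have X3 p q r v : (p *: E + q *: D + r *: H) v = p *: E v + q *: D v + r *: H v.
  by rewrite !add_lfunE !scale_lfunE.
have f3 (f : 'End(V)) p u q w r z :
    f (p *: u + q *: w + r *: z) = p *: f u + q *: f w + r *: f z.
  by rewrite !linearD !linearZ.
apply/lfunP => v; rewrite lfun_commE !X3 !f3 !HEv !HDv !EDv.
apply: eqc => i.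
pose c := coord (vbasis {:V}) i; rewrite -/c.
have cD u w : c (u + w) = c u + c w by exact: linearD.
have cN u : c (- u) = - c u by exact: linearN.
have cZ k u : c (k *: u) = k * c u by exact: linearZ.
do 6!rewrite ?cD ?cN ?cZ.
ring.
Qed.

Definition sl2_of_triple : sl2Module := Sl2Module sl2_triple_rhoP.

Lemma sl2_rho_tripleE x v : sl2_rho sl2_of_triple x v =
  vsval x 0 1 *: E v + vsval x 1 0 *: D v + vsval x 0 0 *: H v.
Proof. by rewrite lfunE /= !add_lfunE !scale_lfunE. Qed.

Lemma sl2_of_tripleE :
  [/\ sl2_rho sl2_of_triple sl2_e_plus = E,
      sl2_rho sl2_of_triple sl2_e_minus = D &
      sl2_rho sl2_of_triple sl2_h = H].
Proof.
split; rewrite lfunE /= /sl2_triple_fun ?sl2_e_plusE ?sl2_e_minusE ?sl2_hE !mxE /=.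
- by rewrite scale1r !scale0r !addr0.
- by rewrite scale1r !scale0r addr0 add0r.
- by rewrite !subr0 scale1r !scale0r !add0r.
Qed.

End Triple.

Section Submodule.
Variables (M : sl2Module) (U : {vspace M}).
Hypothesis stabU : forall x, (sl2_rho M x @: U <= U)%VS.

Definition sl2_sub_act (x : sl2) : 'End(subvs_of U) :=
  (linfun (vsproj U) \o sl2_rho M x \o linfun vsval)%VF.

Lemma sl2_sub_actE x u : vsval (sl2_sub_act x u) = sl2_rho M x (vsval u).
Proof.
rewrite !comp_lfunE !lfunE /= vsprojK //.
by apply: (subvP (stabU x)); apply/memv_img/subvsP.
Qed.

Fact sl2_sub_linear : linear sl2_sub_act.
Proof.
move=> k x y; apply/lfunP => u; apply: val_inj.
by rewrite add_lfunE scale_lfunE linearP /= !sl2_sub_actE linearP add_lfunE scale_lfunE.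
Qed.
HB.instance Definition _ := GRing.isLinear.Build F sl2 'End(subvs_of U) _
  sl2_sub_act sl2_sub_linear.

Fact sl2_sub_rhoP x y : linfun sl2_sub_act (sl2_bracket x y) =
  lfun_comm (linfun sl2_sub_act x) (linfun sl2_sub_act y).
Proof.
have rE z : linfun sl2_sub_act z = sl2_sub_act z by exact: lfunE.
apply/lfunP => u; apply: val_inj; rewrite !rE lfun_commE linearB /=.
by rewrite !sl2_sub_actE sl2_rhoP lfun_commE.
Qed.

Definition sl2_sub : sl2Module := Sl2Module sl2_sub_rhoP.

End Submodule.

Fact sl2_zero_rhoP x y : (0 : 'Hom(sl2, 'End('rV[F]_0))) (sl2_bracket x y) =
  lfun_comm ((0 : 'Hom(sl2, 'End('rV[F]_0))) x)
    ((0 : 'Hom(sl2, 'End('rV[F]_0))) y).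
Proof. by apply/lfunP => u; apply/rowP => -[]. Qed.

Definition sl2_zero : sl2Module := Sl2Module sl2_zero_rhoP.

Section DirectSum.
Variables M N : sl2Module.

Definition sl2_sum_act_fun (x : sl2) (u : M * N) : M * N :=
  (sl2_rho M x u.1, sl2_rho N x u.2).

Fact sl2_sum_act_linear x : linear (sl2_sum_act_fun x).
Proof. by move=> k u v; rewrite /sl2_sum_act_fun !linearP. Qed.
HB.instance Definition _ x := GRing.isLinear.Build F (M * N)%type (M * N)%type _
  (sl2_sum_act_fun x) (sl2_sum_act_linear x).

Definition sl2_sum_act (x : sl2) : 'End((M * N)%type) := linfun (sl2_sum_act_fun x).

Fact sl2_sum_linear : linear sl2_sum_act.
Proof.
move=> k x y; apply/lfunP => u; rewrite add_lfunE scale_lfunE !lfunE /=.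
by rewrite /sl2_sum_act_fun !linearP !add_lfunE !scale_lfunE.
Qed.
HB.instance Definition _ := GRing.isLinear.Build F sl2 'End((M * N)%type) _
  sl2_sum_act sl2_sum_linear.

Fact sl2_sum_rhoP x y : linfun sl2_sum_act (sl2_bracket x y) =
  lfun_comm (linfun sl2_sum_act x) (linfun sl2_sum_act y).
Proof.
have rE z : linfun sl2_sum_act z = sl2_sum_act z by exact: lfunE.
have aE z u : sl2_sum_act z u = (sl2_rho M z u.1, sl2_rho N z u.2).
  exact: lfunE.
by apply/lfunP => u; rewrite !rE lfun_commE !aE !sl2_rhoP !lfun_commE.
Qed.

Definition sl2_sum : sl2Module := Sl2Module sl2_sum_rhoP.

End DirectSum.

(* W (x) M with sl2 acting through M only. *)
Section TensorModule.
Variables (W : vectType F) (M : sl2Module).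

Definition sl2_tensor_act (x : sl2) : 'End(tensor W M) :=
  tens_map \1%VF (sl2_rho M x).

Lemma sl2_tensor_actE x w v :
  sl2_tensor_act x (tens w v) = tens w (sl2_rho M x v).
Proof. by rewrite tens_mapE id_lfunE. Qed.

Fact sl2_tensor_linear : linear sl2_tensor_act.
Proof.
move=> k x y; apply: eq_tens => w v; rewrite add_lfunE scale_lfunE.
by rewrite !sl2_tensor_actE linearP add_lfunE scale_lfunE tensDr.
Qed.
HB.instance Definition _ := GRing.isLinear.Build F sl2 'End(tensor W M) _
  sl2_tensor_act sl2_tensor_linear.

Fact sl2_tensor_rhoP x y : linfun sl2_tensor_act (sl2_bracket x y) =
  lfun_comm (linfun sl2_tensor_act x) (linfun sl2_tensor_act y).
Proof.
have rE z : linfun sl2_tensor_act z = sl2_tensor_act z by exact: lfunE.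
apply: eq_tens => w v; rewrite !rE lfun_commE !sl2_tensor_actE.
rewrite sl2_rhoP lfun_commE.
by rewrite addrC -scaleN1r tensDr scaleN1r addrC.
Qed.

Definition sl2_tensor : sl2Module := Sl2Module sl2_tensor_rhoP.

End TensorModule.

Section Irreducible.
Variable d : nat.

(* v_0, ..., v_d; irr_vec k is zero for k > d. *)
Definition irr_vec (k : nat) : 'rV[F]_d.+1 := \row_j (j == k :> nat)%:R.

Definition irr_lin_fun (f : nat -> 'rV[F]_d.+1) (u : 'rV[F]_d.+1) : 'rV[F]_d.+1 :=
  \sum_(i < d.+1) u 0 i *: f i.

Fact irr_lin_linear f : linear (irr_lin_fun f).
Proof.
move=> k u v; rewrite /irr_lin_fun scaler_sumr -big_split.
by apply: eq_bigr => i _; rewrite !mxE scalerDl scalerA.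
Qed.
HB.instance Definition _ f := GRing.isLinear.Build F 'rV[F]_d.+1 'rV[F]_d.+1 _
  (irr_lin_fun f) (irr_lin_linear f).

Definition irr_lin (f : nat -> 'rV[F]_d.+1) : 'End('rV[F]_d.+1) :=
  linfun (irr_lin_fun f).

Lemma irr_linE f i : (i <= d)%N -> irr_lin f (irr_vec i) = f i.
Proof.
rewrite -ltnS => lid; rewrite lfunE /= /irr_lin_fun (bigD1 (Ordinal lid)) //=.
rewrite mxE eqxx scale1r big1 ?addr0 // => j /negPf h.
by rewrite mxE -val_eqE /= in h *; rewrite h scale0r.
Qed.

Definition irr_e_plus := irr_lin (fun i => (d - i)%:R *: irr_vec i.+1).
Definition irr_e_minus := irr_lin (fun i => i%:R *: irr_vec i.-1).
Definition irr_h := irr_lin (fun i => (2%:R * i%:R - d%:R) *: irr_vec i).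

Lemma eq_irr (f g : 'End('rV[F]_d.+1)) :
  (forall i, (i <= d)%N -> f (irr_vec i) = g (irr_vec i)) -> f = g.
Proof.
move=> fg; apply/lfunP => u; rewrite [u]row_sum_delta !linear_sum.
apply: eq_bigr => i _; rewrite !linearZ /=; congr (_ *: _).
have -> : delta_mx 0 i = irr_vec i :> 'rV[F]_d.+1.
  by apply/rowP => j; rewrite !mxE eqxx.
by apply: fg; rewrite -ltnS.
Qed.

Lemma irr_e_plusE i : (i <= d)%N ->
  irr_e_plus (irr_vec i) = (d - i)%:R *: irr_vec i.+1.
Proof. exact: irr_linE. Qed.
Lemma irr_e_minusE i : (i <= d)%N ->
  irr_e_minus (irr_vec i) = i%:R *: irr_vec i.-1.
Proof. exact: irr_linE. Qed.
Lemma irr_hE i : (i <= d)%N ->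
  irr_h (irr_vec i) = (2%:R * i%:R - d%:R) *: irr_vec i.
Proof. exact: irr_linE. Qed.

Let irrZ (f : 'End('rV[F]_d.+1)) k v : f (k *: v) = k *: f v.
Proof. exact: linearZ. Qed.

Fact irr_HE : lfun_comm irr_h irr_e_plus = 2%:R *: irr_e_plus.
Proof.
apply: eq_irr => i lid; rewrite lfun_commE scale_lfunE.
rewrite irr_hE // !irr_e_plusE // !irrZ irr_e_plusE // !scalerA.
case: (ltngtP i d) lid => // [lid|->] _; last first.
  by rewrite subnn !(mul0r, mulr0, scale0r) ?oppr0 ?addr0 ?subrr.
rewrite irr_hE // scalerA -scalerBl; congr (_ *: _); ring.
Qed.

Fact irr_HD : lfun_comm irr_h irr_e_minus = - 2%:R *: irr_e_minus.
Proof.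
apply: eq_irr => i lid; rewrite lfun_commE scale_lfunE.
rewrite irr_hE // !irr_e_minusE // !irrZ irr_e_minusE // !scalerA.
case: i lid => [|i] lid.
  by rewrite !(mul0r, mulr0, scale0r) ?oppr0 ?addr0 ?subrr.
rewrite irr_hE ?(ltnW lid) // scalerA -scalerBl; congr (_ *: _); ring.
Qed.

Fact irr_ED : lfun_comm irr_e_plus irr_e_minus = irr_h.
Proof.
apply: eq_irr => i lid; rewrite lfun_commE.
rewrite irr_hE // irr_e_minusE // irr_e_plusE // !irrZ.
have -> : i%:R *: irr_e_plus (irr_vec i.-1) = (i%:R * (d%:R - i%:R + 1)) *: irr_vec i.
  case: i lid => [|i] lid; first by rewrite mul0r !scale0r.
  rewrite irr_e_plusE ?(ltnW lid) // scalerA /= natrB ?(ltnW lid) //.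
  by congr (_ *: _); ring.
have -> : (d - i)%:R *: irr_e_minus (irr_vec i.+1) =
  ((d%:R - i%:R) * (i%:R + 1)) *: irr_vec i.
  rewrite natrB //; case: (ltngtP i d) lid => // [lid|->] _; last first.
    by rewrite subrr mul0r !scale0r.
  by rewrite irr_e_minusE // scalerA /=; congr (_ *: _); ring.
by rewrite -scalerBl; congr (_ *: _); ring.
Qed.

Definition sl2_irr : sl2Module := sl2_of_triple irr_HE irr_HD irr_ED.

End Irreducible.

End Sl2.

Section GraphAlgebraModule.
Variables (F : fieldType) (m : nat).
Implicit Types S : {set 'I_m}.
Local Notation x_ := (@gmon F m).

Lemma gD_plusE S : gD_plus F m (x_ S) = \sum_(e | e \notin S) x_ (e |: S).
Proof. exact: glinE. Qed.
Lemma gD_minusE S : gD_minus F m (x_ S) = \sum_(e in S) x_ (S :\ e).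
Proof. exact: glinE. Qed.
Lemma gD_zeroE S :
  gD_zero F m (x_ S) = - (m%:R - 2%:R * #|S|%:R) *: x_ S.
Proof. exact: glinE. Qed.
Lemma gactE (s : 'S_m) S : gact F s (x_ S) = x_ (s @: S).
Proof. exact: glinE. Qed.

Let lZ (f : 'End(galg F m)) k v : f (k *: v) = k *: f v.
Proof. exact: linearZ. Qed.

Fact gD_zero_plus : lfun_comm (gD_zero F m) (gD_plus F m) = 2%:R *: gD_plus F m.
Proof.
apply: eq_gmon => S; rewrite lfun_commE scale_lfunE gD_zeroE lZ gD_plusE.
rewrite linear_sum !scaler_sumr -sumrB; apply: eq_bigr => e eS.
rewrite /= gD_zeroE cardsU1 eS -scalerBl natrD /=; congr (_ *: _); ring.
Qed.

Fact gD_zero_minus :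
  lfun_comm (gD_zero F m) (gD_minus F m) = - 2%:R *: gD_minus F m.
Proof.
apply: eq_gmon => S; rewrite lfun_commE scale_lfunE gD_zeroE lZ gD_minusE.
rewrite linear_sum !scaler_sumr -sumrB; apply: eq_bigr => e eS.
rewrite /= gD_zeroE (cardsD1 e S) eS -scalerBl natrD /=; congr (_ *: _); ring.
Qed.

Fact gD_plus_minus : lfun_comm (gD_plus F m) (gD_minus F m) = gD_zero F m.
Proof.
apply: eq_gmon => S; rewrite lfun_commE gD_zeroE gD_plusE gD_minusE.
rewrite (linear_sum (gD_plus F m)) (linear_sum (gD_minus F m)) /=.
have -> : \sum_(e in S) gD_plus F m (x_ (S :\ e)) = #|S|%:R *: x_ S +
    \sum_(e in S) \sum_(f | f \notin S) x_ (f |: S :\ e).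
  rewrite scaler_nat -sumr_const -big_split; apply: eq_bigr => e eS.
  rewrite gD_plusE (bigD1 e) /= ?setD11 // setD1K //; congr (_ + _).
  apply: eq_bigl => f; rewrite !inE negb_and negbK.
  by case: (eqVneq f e) => [->|]; rewrite ?eS // andbT.
have -> : \sum_(f | f \notin S) gD_minus F m (x_ (f |: S)) = (m - #|S|)%:R *: x_ S +
    \sum_(f | f \notin S) \sum_(e in S) x_ (f |: S :\ e).
  have -> : (m - #|S|)%N = #|[pred f | f \notin S]|.
    have := congr1 (subn^~ #|S|) (cardC (mem S)).
    by rewrite addKn card_ord => <-; apply: eq_card.
  rewrite scaler_nat -sumr_const -big_split; apply: eq_bigr => f fS.
  rewrite gD_minusE (bigD1 f) /= ?setU11 // setU1K //; congr (_ + _).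
  apply: eq_big => [e|e].
    by rewrite !inE; case: (eqVneq e f) => [->|] /=; rewrite ?(negPf fS) ?andbT.
  move=> /andP[_ ef]; congr x_; apply/setP => g; rewrite !inE.
  by case: (eqVneq g f) => [->|] //=; rewrite ?andbT // eq_sym ef.
rewrite [X in _ + X - _]exchange_big opprD addrACA subrr addr0 -scalerBl.
congr (_ *: _); rewrite natrB; first ring.
by have := max_card (mem S); rewrite card_ord.
Qed.

Definition sl2_galg : sl2Module F :=
  sl2_of_triple gD_zero_plus gD_zero_minus gD_plus_minus.

Lemma gD_plus_act (s : 'S_m) a :
  gact F s (gD_plus F m a) = gD_plus F m (gact F s a).
Proof.
rewrite -!comp_lfunE; congr (fun_of_lfun _ a); apply: eq_gmon => S.
rewrite !comp_lfunE gactE !gD_plusE linear_sum [RHS](reindex_inj (@perm_inj _ s)) /=.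
apply: eq_big => e; first by rewrite mem_imset //; apply: perm_inj.
by move=> _; rewrite gactE imsetU1.
Qed.

Lemma gD_minus_act (s : 'S_m) a :
  gact F s (gD_minus F m a) = gD_minus F m (gact F s a).
Proof.
rewrite -!comp_lfunE; congr (fun_of_lfun _ a); apply: eq_gmon => S.
rewrite !comp_lfunE gactE !gD_minusE linear_sum [RHS](reindex_inj (@perm_inj _ s)) /=.
apply: eq_big => e; first by rewrite mem_imset //; apply: perm_inj.
move=> _; rewrite gactE; congr x_; apply/setP => i.
rewrite -(permKV s i) !inE !mem_imset; try exact: perm_inj.
by rewrite !inE (inj_eq perm_inj).
Qed.

Lemma gD_zero_act (s : 'S_m) a :
  gact F s (gD_zero F m a) = gD_zero F m (gact F s a).
Proof.
rewrite -!comp_lfunE; congr (fun_of_lfun _ a); apply: eq_gmon => S.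
rewrite !comp_lfunE gactE !gD_zeroE lZ gactE card_imset //; exact: perm_inj.
Qed.

Variable G : {set 'S_m}.

Definition galg_inv : {vspace galg F m} := invariants (@gact F m) G fullv.

Fact galg_inv_stable x : (sl2_rho sl2_galg x @: galg_inv <= galg_inv)%VS.
Proof.
apply/subvP => _ /memv_imgP[a /invariantsP[_ aG] ->].
apply/invariantsP; split=> [|g gG]; first exact: memvf.
have rE : sl2_rho sl2_galg x a = vsval x 0 1 *: gD_plus F m a +
    vsval x 1 0 *: gD_minus F m a + vsval x 0 0 *: gD_zero F m a :> galg F m.
  exact: sl2_rho_tripleE.
rewrite {}rE !(linearD (gact F g)) /= !lZ.
by rewrite gD_plus_act gD_minus_act gD_zero_act aG.
Qed.

Definition sl2_galg_inv : sl2Module F := sl2_sub galg_inv_stable.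

End GraphAlgebraModule.

Definition specht_inv (F : fieldType) m (G : {set 'S_m}) (shape : seq nat) :=
  invariants (@perm_module_act F m shape) G (specht F m shape).

(* Main.v *)
Require Import Defs.
From HB Require Import structures.
From mathcomp Require Import all_boot all_order all_algebra all_fingroup.
From mathcomp Require Import reals complex ring zify.

Set Implicit Arguments.
Unset Strict Implicit.
Unset Printing Implicit Defensive.

Import GRing.Theory.

Local Open Scope ring_scope.

(** The proof separates the action of sl_2 from the action of the group.

    On the sl_2 side, a module M in characteristic 0 that is spanned by vectors
    of weights 2j - m, for 0 <= j <= m, is determined by its lowest weight
    vectors. If P_k is the space of vectors of weight 2k - m killed by e_-, then
    each u in P_k spans under e_+ a string u, e_+ u, ..., e_+^(m - 2k) u, which
    is a copy of V_(m - 2k) up to rescaling. This gives a map from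
    P_k (x) V_(m - 2k) to M ([string_map]). It is injective because e_-^i e_+^i
    acts on P_k by a nonzero scalar; the images for different k are independent
    because the Casimir operator acts on them by different scalars; and they
    fill M by [generated_by_lowest]. The result is [weight_module_decomp].

    On the combinatorial side, what must be shown is that the vectors of degree
    k killed by D_- form a copy of the Specht module S^(m-k,k), compatibly with
    permutations. A tabloid of shape (m-k, k) is the k-subset in its second row,
    so tabloids become monomials x_S of degree k; under this injection a
    polytabloid becomes the product of the differences x_b - x_a over its k
    two-entry columns (a, b) ([tabloid_monomial_polytabloid]). Such products are
    killed by D_-. Conversely they span the kernel ([ker_gD_minus_span]), by
    induction on the set of variables: writing v = x_e a + b with a, b free of
    x_e, the vector a is again in the kernel and hence a combination of products
    of k - 1 differences, each of which leaves some variable x_c unused;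
    multiplying by x_e - x_c and subtracting from v removes x_e altogether. The
    spare x_c runs out only when 2k exceeds the number of variables, and there
    the kernel is zero ([iter_gD_minus_inj]).

    Both parts are compatible with any set of permutations, so that the theorem
    holds over any field of characteristic 0 and any set of permutations of the
    variables ([galg_inv_decomposition]). *)

(** * Eigenvectors and direct sums of sl_2-modules *)

(** Apply f - c x to the vanishing sum, where x is the first index: this kills
    u x and rescales the other terms by the nonzero c i - c x. *)
Lemma eigenvectors_free (F : fieldType) (V : vectType F) (f : V -> V)
    (I : eqType) (r : seq I) (c : I -> F) (u : I -> V) :
  linear f -> uniq r -> {in r &, injective c} ->
  {in r, forall i, f (u i) = c i *: u i} ->
  \sum_(i <- r) u i = 0 -> {in r, forall i, u i = 0}.
Proof.
move=> lf; pose f' : {linear V -> V} :=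
  HB.pack f (GRing.isLinear.Build _ _ _ _ _ lf).
have f0 : f 0 = 0 by rewrite -[f _]/(f' _) linear0.
have fZ a v : f (a *: v) = a *: f v by rewrite -[f _]/(f' _) linearZ.
have fD v w : f (v + w) = f v + f w by exact: (linearD f').
have fS s w : f (\sum_(i <- s) w i) = \sum_(i <- s) f (w i).
  exact: (linear_sum f').
elim: r u => [//|x r IH] u /= /andP[xr ur] c_inj fu; rewrite big_cons => u0.
have {}IH : {in r, forall i, u i = 0}.
  move=> i ir; have := IH (fun i => (c i - c x) *: u i) ur.
  move=> /(_ _ _ _ i ir) /= h.
  have /eqP : (c i - c x) *: u i = 0.
    apply: h => [j k jr kr|j jr|]; first by apply: c_inj; rewrite inE ?jr ?kr orbT.
      by rewrite fZ fu ?inE ?jr ?orbT // !scalerA mulrC.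
    have : f (u x + \sum_(i <- r) u i) - c x *: (u x + \sum_(i <- r) u i) = 0.
      by rewrite u0 f0 scaler0 subr0.
    rewrite fD fS /= fu ?mem_head // scalerDr opprD addrACA subrr.
    rewrite add0r scaler_sumr -sumrB => h; rewrite -[RHS]h !big_seq.
    apply: eq_bigr => j jr; rewrite fu ?inE ?jr ?orbT //.
    by rewrite scalerBl.
  rewrite scaler_eq0 subr_eq0 => /orP[/eqP/c_inj|/eqP //].
  rewrite !inE eqxx ir orbT => /(_ isT isT) ix.
  by rewrite -ix ir in xr.
move=> i; rewrite inE => /orP[/eqP->|/IH //].
by move: u0; rewrite big_seq big1 ?addr0.
Qed.

Section Sl2Hom.
Variables (F : fieldType).
Implicit Types M N : sl2Module F.

Definition sl2_equivariant M N (f : 'Hom(M, N)) :=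
  forall x v, f (sl2_rho M x v) = sl2_rho N x (f v).

Lemma sl2_decomp (x : subvs_of (sl2_space F)) :
  x = vsval x 0 1 *: sl2_e_plus F + vsval x 1 0 *: sl2_e_minus F
      + vsval x 0 0 *: sl2_h F.
Proof.
apply: val_inj; rewrite !linearD !linearZ /= sl2_e_plusE sl2_e_minusE sl2_hE.
have := subvsP x; rewrite mem_sl2 /mxtrace !big_ord_recl big_ord0 addr0.
rewrite (_ : lift ord0 ord0 = 1); last exact: val_inj.
rewrite (_ : ord0 = 0) // addrC addr_eq0 => /eqP x11.
have two (P : 'I_2 -> Prop) : P 0 -> P 1 -> forall i, P i.
  move=> P0 P1 i; case: (unliftP 0 i) => [j|] ->; rewrite ?ord1 //.
  by rewrite (_ : lift _ _ = 1) //; apply: val_inj.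
apply/matrixP => i j; rewrite !mxE.
by move: i j; apply: (two); apply: (two); rewrite ?x11 /=; ring.
Qed.

Lemma sl2_equivariant_gen M N (f : 'Hom(M, N)) :
  (forall v, f (sl2_rho M (sl2_e_plus F) v) = sl2_rho N (sl2_e_plus F) (f v)) ->
  (forall v, f (sl2_rho M (sl2_e_minus F) v) = sl2_rho N (sl2_e_minus F) (f v)) ->
  (forall v, f (sl2_rho M (sl2_h F) v) = sl2_rho N (sl2_h F) (f v)) ->
  sl2_equivariant f.
Proof.
move=> fp fm fh x v; rewrite (sl2_decomp x) !linearD !linearZ.
by rewrite !add_lfunE !scale_lfunE !linearD !linearZ /= fp fm fh.
Qed.

Lemma sl2_sum_rhoE M N x u :
  sl2_rho (sl2_sum M N) x u = (sl2_rho M x u.1, sl2_rho N x u.2).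
Proof.
have -> : sl2_rho (sl2_sum M N) x = sl2_sum_act M N x by exact: lfunE.
exact: lfunE.
Qed.

(** The iterated sum is a nested product type, known only through its two
    operations; its elements are therefore never decomposed, and the image of the
    embedding is described by families of vectors of M instead. *)
Lemma sl2_bigsum_embed M (I : eqType) (r : seq I) (N : I -> sl2Module F)
    (f : forall i, 'Hom(N i, M)) :
  uniq r -> {in r, forall i, sl2_equivariant (f i)} ->
  {in r, forall i, injective (f i)} ->
  (forall u : I -> M, {in r, forall i, u i \in limg (f i)} ->
     \sum_(i <- r) u i = 0 -> {in r, forall i, u i = 0}) ->
  exists g : 'Hom(\big[@sl2_sum F / sl2_zero F]_(i <- r) N i, M),
    [/\ sl2_equivariant g, injective g &
      forall v : M, v \in limg g <->
      exists2 u : I -> M, {in r, forall i, u i \in limg (f i)} &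
        v = \sum_(i <- r) u i].
Proof.
move=> ur; elim: r ur => [_ _ _ _|i r IH /= /andP[ir ur] eqf injf free].
  rewrite big_nil; exists 0; split=> [x v|u v _|v].
  - by rewrite !lfunE /= linear0.
  - by apply/rowP => -[].
  - split=> [/memv_imgP[y _ ->]|[u _ ->]]; last by rewrite big_nil mem0v.
    by exists (fun=> 0) => //; rewrite big_nil lfunE.
have [| |v vr v0|g [eqg injg img]] := IH ur.
- by move=> j jr; apply: eqf; rewrite inE jr orbT.
- by move=> j jr; apply: injf; rewrite inE jr orbT.
(* A relation among the tail is one in i :: r with i-th term 0. *)
- pose v' j := if j == i then 0 else v j.
  have v'E j : j \in r -> v' j = v j.
    by rewrite /v'; case: eqP => // -> /(negP ir).
  move=> j jr; rewrite -v'E //; apply: (free v'); last by rewrite inE jr orbT.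
    move=> k; rewrite inE /v'; case: eqP => [-> _|_ /= kr]; first exact: mem0v.
    exact: vr.
  rewrite big_cons {1}/v' eqxx add0r -[RHS]v0 !big_seq.
  by apply: eq_bigr => k /v'E.
rewrite big_cons; set B := \big[_/_]_(j <- r) N j in g eqg injg img *.
pose h (p : sl2_sum (N i) B) : M := f i p.1 + g p.2.
have lh : linear h by move=> k p q; rewrite /h !linearP scalerDr addrACA.
pose h' : {linear sl2_sum (N i) B -> M} :=
  HB.pack h (GRing.isLinear.Build _ _ _ _ _ lh).
have [gh hE] : exists gh : 'Hom(sl2_sum (N i) B, M),
    forall p : sl2_sum (N i) B, gh p = f i p.1 + g p.2.
  by exists (linfun h') => p; apply: lfunE.
exists gh.
split=> [x v|p q|v].
- by rewrite (hE (sl2_rho (sl2_sum (N i) B) x v)) (hE v) sl2_sum_rhoE /=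
       (eqf _ (mem_head _ _)) eqg linearD.
- rewrite (hE p) (hE q) => pq.
  have pq0 : f i (p.1 - q.1) + g (p.2 - q.2) = 0.
    by rewrite !linearB /= addrACA -opprD pq subrr.
  have /img[u ur' gu] : g (p.2 - q.2) \in limg g by apply: memv_img (memvf _).
  pose u' j := if j == i then f i (p.1 - q.1) else u j.
  have u'E j : j \in r -> u' j = u j.
    by rewrite /u'; case: eqP => // -> /(negP ir).
  have u'0 : {in i :: r, forall j, u' j = 0}.
    apply: free => [j|].
      rewrite inE /u'; case: eqP => [-> _|_ /= /ur' //].
      by apply: memv_img (memvf _).
    rewrite big_cons {1}/u' eqxx -[RHS]pq0 gu; congr (_ + _).
    by rewrite !big_seq; apply: eq_bigr => k /u'E.
  have e1 : p.1 = q.1.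
    apply/eqP; rewrite -subr_eq0; apply/eqP/(injf _ (mem_head _ _)).
    by have := u'0 i (mem_head _ _); rewrite /u' eqxx linear0.
  have e2 : p.2 = q.2.
    apply/eqP; rewrite -subr_eq0; apply/eqP/injg; rewrite gu linear0.
    by rewrite big_seq big1 // => j jr; rewrite -u'E // u'0 // inE jr orbT.
  by case: p q e1 e2 {pq pq0 gu u' u'E u'0} => [? ?] [? ?] /= -> ->.
- split=> [/memv_imgP[p _ ->]|[u ur' ->]].
    have /img[u ur' gu] : g p.2 \in limg g by apply: memv_img (memvf _).
    exists (fun j => if j == i then f i p.1 else u j).
      move=> j; rewrite inE; case: eqP => [-> _|_ /= /ur' //].
      by apply: memv_img (memvf _).
    rewrite (hE p) big_cons eqxx gu !big_seq; congr (_ + _); apply: eq_bigr => j jr.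
    by case: eqP jr => // -> /(negP ir).
  rewrite big_cons.
  have /memv_imgP[x _ ->] := ur' i (mem_head _ _).
  have /memv_imgP[y _ ->] : \sum_(j <- r) u j \in limg g.
    by apply/img; exists u => // j jr; apply: ur'; rewrite inE jr orbT.
  by rewrite -(hE (x, y)); apply: memv_img (memvf _).
Qed.

Lemma sl2_isomorphic_bigsum M (I : eqType) (r : seq I) (N : I -> sl2Module F)
    (f : forall i, 'Hom(N i, M)) :
  uniq r -> {in r, forall i, sl2_equivariant (f i)} ->
  {in r, forall i, injective (f i)} ->
  (forall u : I -> M, {in r, forall i, u i \in limg (f i)} ->
     \sum_(i <- r) u i = 0 -> {in r, forall i, u i = 0}) ->
  (forall v : M, exists2 u : I -> M, {in r, forall i, u i \in limg (f i)} &
     v = \sum_(i <- r) u i) ->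
  sl2_isomorphic M (\big[@sl2_sum F / sl2_zero F]_(i <- r) N i).
Proof.
move=> ur eqf injf free span.
have [g [eqg /lker0P kg img]] := sl2_bigsum_embed ur eqf injf free.
have imgg v : v \in limg g by apply/img/span.
have gK := lker0_lfunK kg; have gVK v := limg_lfunVK (imgg v).
exists (g^-1)%VF; split=> [|x v]; first by exists g.
by apply: (can_inj gK); rewrite eqg !gVK.
Qed.

End Sl2Hom.

(** * Weight modules are sums of strings of lowest weight vectors *)

Section WeightModule.
Variables (F : fieldType) (M : sl2Module F) (m : nat).
Hypothesis pchar0 : [pchar F] =i pred0.

Let natr_eq0 n : (n%:R == 0 :> F) = (n == 0%N).
Proof. exact: (pcharf0P F).1. Qed.

Let natr_inj n p : n%:R = p%:R :> F -> n = p.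
Proof.
wlog le : n p / (n <= p)%N => [h|].
  by case: (leqP n p) => [/h //|/ltnW /h {}h /esym /h ->].
move/eqP; rewrite eq_sym -subr_eq0 -natrB // natr_eq0 subn_eq0 => le'.
by apply/eqP; rewrite eqn_leq le.
Qed.

Local Notation E := (sl2_rho M (sl2_e_plus F)).
Local Notation D := (sl2_rho M (sl2_e_minus F)).
Local Notation H := (sl2_rho M (sl2_h F)).

Lemma sl2_HE v : H (E v) = E (H v) + 2%:R *: E v.
Proof.
have [he _ _] := sl2_relations F.
have := congr1 (fun x => sl2_rho M x v) he.
by rewrite sl2_rhoP lfun_commE linearZ scale_lfunE /= => <-; rewrite addrC subrK.
Qed.

Lemma sl2_HD v : H (D v) = D (H v) - 2%:R *: D v.
Proof.
have [_ hd _] := sl2_relations F.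
have := congr1 (fun x => sl2_rho M x v) hd.
rewrite sl2_rhoP lfun_commE linearZ scale_lfunE /= scaleNr => <-.
by rewrite addrC subrK.
Qed.

Lemma sl2_DE v : D (E v) = E (D v) - H v.
Proof.
have [_ _ ed] := sl2_relations F.
by rewrite -ed sl2_rhoP lfun_commE opprB addrC subrK.
Qed.

Definition weight (j : nat) : F := 2%:R * j%:R - m%:R.

Lemma weight_inj : injective weight.
Proof.
move=> i j /addIr /eqP; rewrite -!natrM => /eqP /natr_inj; lia.
Qed.

Definition has_weight j (v : M) := H v = weight j *: v.
Definition lowest j (v : M) := D v = 0 /\ has_weight j v.

Lemma has_weight_E j v : has_weight j v -> has_weight j.+1 (E v).
Proof.
rewrite /has_weight sl2_HE => ->; rewrite linearZ -scalerDl /=.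
by congr (_ *: _); rewrite /weight -natr1; ring.
Qed.

Lemma has_weight_iterE j i v :
  has_weight j v -> has_weight (j + i) (iter i E v).
Proof.
by move=> jv; elim: i => [|i /has_weight_E]; rewrite ?addn0 // addnS.
Qed.

Lemma has_weight_D j v : has_weight j.+1 v -> has_weight j (D v).
Proof.
rewrite /has_weight sl2_HD => ->; rewrite linearZ -scalerBl /=.
by congr (_ *: _); rewrite /weight -natr1; ring.
Qed.

Lemma has_weight_iterD j i v :
  has_weight (j + i) v -> has_weight j (iter i D v).
Proof.
elim: i j => [|i IH] j; first by rewrite addn0.
by rewrite addnS -addSn => /IH /has_weight_D.
Qed.

(** Moving e_- to the right past the factors e_+ costs one term per factor, a
    multiple of e_+^i v given by its weight. *)
Lemma D_iterE j i v : has_weight j v ->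
  D (iter i.+1 E v) = iter i.+1 E (D v) +
    (i.+1%:R * (m%:R - 2%:R * j%:R - i%:R)) *: iter i E v.
Proof.
move=> jv; elim: i => [|i IH].
  by rewrite /= sl2_DE jv -scaleNr /weight; congr (_ + _ *: _); ring.
rewrite iterS sl2_DE IH (has_weight_iterE i.+1 jv) linearD linearZ /= -addrA.
congr (_ + _); rewrite -scalerBl; congr (_ *: _).
by rewrite /weight natrD -!natr1; ring.
Qed.

Lemma lowest_D_iterE j i v : lowest j v ->
  D (iter i.+1 E v) = (i.+1%:R * (m%:R - 2%:R * j%:R - i%:R)) *: iter i E v.
Proof.
case=> Dv jv; rewrite (D_iterE _ jv) Dv.
suff -> : iter i.+1 E 0 = 0 by rewrite add0r.
by elim: i.+1 => //= k ->; rewrite linear0.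
Qed.

(** The scalar is the product of the (i+1)(m - 2j - i) for i < r, which are
    nonzero as long as the string of v has not ended. *)
Lemma lowest_iterD_iterE j r v : lowest j v -> (2 * j + r <= m)%N ->
  exists2 c : F, c != 0 & iter r D (iter r E v) = c *: v.
Proof.
move=> lv; elim: r => [_|r IH le].
  by exists 1; rewrite ?oner_eq0 // scale1r.
have [|c c0 IHc] := IH; first lia.
exists (((r.+1 * (m - 2 * j - r))%N)%:R * c).
  by rewrite mulf_neq0 // natr_eq0 muln_eq0 negb_or /=; lia.
rewrite iterSr (lowest_D_iterE _ lv).
have -> : r.+1%:R * (m%:R - 2%:R * j%:R - r%:R) =
    (r.+1 * (m - 2 * j - r))%:R :> F.
  by rewrite natrM !natrB ?natrM //; lia.
move: (_%:R) => b; rewrite -scalerA -IHc.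
elim: (r) (iter r E v) => [|k IHk] w //=.
by rewrite IHk linearZ.
Qed.

Hypothesis wtM : forall v : M, exists2 u : nat -> M,
  forall j, has_weight j (u j) & v = \sum_(0 <= j < m.+1) u j.

(** Such a v would be an eigenvector independent of the components that it is
    the sum of. *)
Lemma not_weight_eq0 c v : H v = c *: v ->
  (forall j, (j <= m)%N -> c != weight j) -> v = 0.
Proof.
move=> Hv nc; have [u wu vu] := wtM v.
(* The slot m.+1 is used for v itself. *)
pose c' j := if (j <= m)%N then weight j else c.
pose u' j := if (j <= m)%N then u j else - v.
have -> : v = - u' m.+1 by rewrite /u' ltnn opprK.
apply/eqP; rewrite oppr_eq0; apply/eqP.
apply: (@eigenvectors_free F M H _ (index_iota 0 m.+2) c' u').
- by move=> k x y; rewrite linearP.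
- exact: iota_uniq.
- move=> i j; rewrite !mem_index_iota /= /c' => ilt jlt.
  case: leqP => im; case: leqP => jm; [exact: weight_inj| | |lia].
    by move/eqP; rewrite eq_sym (negPf (nc i im)).
  by move/eqP; rewrite (negPf (nc j jm)).
- move=> j _; rewrite /u' /c'; case: ifP => _; first exact: wu.
  by rewrite linearN /= Hv scalerN.
- rewrite big_nat_recr //= {2}/u' ltnn {1}vu.
  apply/eqP; rewrite subr_eq0; apply/eqP/eq_big_nat => j /= jm.
  by rewrite /u' -ltnS jm.
- by rewrite mem_index_iota ltnSn.
Qed.

Lemma has_weight_gt j v : has_weight j v -> (m < j)%N -> v = 0.
Proof.
move=> jv mj; apply: not_weight_eq0 jv _ => i im.
by apply/eqP => /weight_inj; lia.
Qed.

Lemma has_weight0_D v : has_weight 0 v -> D v = 0.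
Proof.
move=> v0; apply: (@not_weight_eq0 (- 2%:R - m%:R)).
  rewrite sl2_HD v0 linearZ -scalerBl /=; congr (_ *: _).
  by rewrite /weight; ring.
move=> j jm; rewrite /weight -subr_eq0.
have -> : - 2%:R - m%:R - (2%:R * j%:R - m%:R) = - (2 + 2 * j)%:R :> F.
  by rewrite natrD natrM; ring.
by rewrite oppr_eq0 natr_eq0.
Qed.

(** Modulo N the vector v is a lowest weight vector of positive weight. Then
    e_- e_+^(i+1) v is a nonzero multiple of e_+^i v for every i, while e_+^i v
    vanishes for large i, so all e_+^i v lie in N, down to v itself. *)
Lemma mem_of_positive_weight (N : {vspace M}) j v :
  (forall x, x \in N -> E x \in N) -> (forall x, x \in N -> D x \in N) ->
  has_weight j v -> (m < 2 * j)%N -> D v \in N -> v \in N.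
Proof.
move=> NE ND jv mj DvN.
have step i : iter i.+1 E v \in N -> iter i E v \in N.
  move/ND; rewrite (D_iterE _ jv) rpredDl; last first.
    by elim: i.+1 => //= k; apply: NE.
  have -> : i.+1%:R * (m%:R - 2%:R * j%:R - i%:R) =
     - (i.+1 * (2 * j + i - m))%:R :> F.
    rewrite natrM natrB ?natrD ?natrM; [ring|lia].
  rewrite rpredZeq oppr_eq0 natr_eq0 muln_eq0 /=.
  by case: eqP => //; lia.
have : iter m.+1 E v \in N.
  by rewrite (has_weight_gt (has_weight_iterE m.+1 jv)) ?mem0v //; lia.
by elim: m.+1 => //= i IH /step.
Qed.

Lemma lowest_gt j v : lowest j v -> (m < 2 * j)%N -> v = 0.
Proof.
case=> Dv jv mj; apply/eqP; rewrite -memv0.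
apply: (mem_of_positive_weight _ _ jv mj); last by rewrite Dv mem0v.
  by move=> x; rewrite !memv0 => /eqP ->; rewrite linear0.
by move=> x; rewrite !memv0 => /eqP ->; rewrite linear0.
Qed.

(** This vector is killed by e_-, and its weight m - 2k + 2 is positive. *)
Lemma lowest_string_end k u : lowest k u -> (2 * k <= m)%N ->
  iter (m - 2 * k).+1 E u = 0.
Proof.
move=> lu le; apply: (@lowest_gt (k + (m - 2 * k).+1)); last lia.
split; last by apply: has_weight_iterE; case: lu.
rewrite (lowest_D_iterE _ lu) natrB // natrM.
by rewrite [_ * (_ - _)](_ : _ = 0) ?scale0r //; ring.
Qed.

(** In weights at most 0, induct on the least r with e_-^r v = 0: the vector
    e_-^(r-1) v is a lowest weight vector, and subtracting a multiple of
    e_+^(r-1) e_-^(r-1) v from v lowers r. Positive weights follow one after the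
    other from [mem_of_positive_weight]. *)
Lemma generated_by_lowest (N : {vspace M}) :
  (forall x, x \in N -> E x \in N) -> (forall x, x \in N -> D x \in N) ->
  (forall k u, (2 * k <= m)%N -> lowest k u -> u \in N) ->
  forall v, v \in N.
Proof.
move=> NE ND NP.
have NEi i x : x \in N -> iter i E x \in N.
  by move=> xN; elim: i => //= i; apply: NE.
have low j : (2 * j <= m)%N -> forall r v, (r <= j.+1)%N ->
    has_weight j v -> iter r D v = 0 -> v \in N.
  move=> jm; elim=> [|r IH] v rj jv; first by move=> /= ->; rewrite mem0v.
  move=> Drv; set u := iter r D v.
  have lu : lowest (j - r) u.
    by split; [exact: Drv|apply: has_weight_iterD; rewrite subnK].
  have [|c c0 Eu] := @lowest_iterD_iterE (j - r) r u lu; first lia.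
  have uN : iter r E u \in N by apply/NEi/(NP (j - r)%N) => //; lia.
  rewrite -(subrK (c^-1 *: iter r E u) v) rpredD ?rpredZ //.
  apply: IH; first lia.
    rewrite /has_weight linearB linearZ /= jv.
    have := has_weight_iterE r (proj2 lu); rewrite subnK ?ltnS // => ->.
    by rewrite scalerBr !scalerA mulrC.
  have iB i x y : iter i D (x - c^-1 *: y) = iter i D x - c^-1 *: iter i D y.
    by elim: i => //= i ->; rewrite linearB linearZ.
  by rewrite iB Eu scalerA mulVf // scale1r subrr.
have allN j : forall v, has_weight j v -> v \in N.
  elim: j => [|j IH] v jv.
    by apply: (low 0%N _ 1%N) => //; apply: has_weight0_D.
  have [le|gt] := leqP (2 * j.+1) m.
    apply: (low j.+1 le j.+2) => //.
    exact: has_weight0_D (@has_weight_iterD 0 j.+1 _ jv).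
  by apply: (mem_of_positive_weight NE ND jv gt); apply/IH/has_weight_D.
move=> v; have [u wu ->] := wtM v.
by apply: memv_suml => j _; apply/allN/wu.
Qed.

(** Twice the Casimir element e_+ e_- + e_- e_+ + h^2 / 2, with e_- moved to the
    right; it acts on a string of lowest weight -d by d (d + 2). *)
Definition casimir : 'End(M) := 4%:R *: (E \o D)%VF + (H \o H)%VF - 2%:R *: H.

Lemma casimirE v : casimir v = 4%:R *: E (D v) + H (H v) - 2%:R *: H v.
Proof. by rewrite !(add_lfunE, opp_lfunE, scale_lfunE, comp_lfunE). Qed.

Lemma casimir_string k i u : lowest k u -> (2 * k <= m)%N ->
  casimir (iter i E u) = ((m - 2 * k) * (m - 2 * k + 2))%:R *: iter i E u.
Proof.
move=> lu km; rewrite casimirE.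
have [_ /(@has_weight_iterE _ i) wi] := lu.
have -> : E (D (iter i E u)) =
    (i%:R * (m%:R - 2%:R * k%:R - i%:R + 1)) *: iter i E u.
  case: i {wi} => [|i]; first by rewrite /= lu.1 linear0 mul0r scale0r.
  rewrite (lowest_D_iterE _ lu) linearZ /= -natr1; congr (_ *: _); ring.
have HZ a x : H (a *: x) = a *: H x by exact: linearZ.
rewrite !wi HZ wi !scalerA -scalerDl -scalerBl; congr (_ *: _).
rewrite /weight natrM !natrD natrB // natrM; ring.
Qed.

Section String.
Variables (W : vectType F) (k : nat) (phi : 'Hom(W, M)).
Hypothesis km : (2 * k <= m)%N.
Hypothesis phi_inj : injective phi.
Hypothesis phiP : forall w, lowest k (phi w).
Let d := (m - 2 * k)%N.

(** The basis of V_d is normalised by e_+ v_i = (d - i) v_(i+1), so v_i is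
    (d-i)!/d! times e_+^i v_0. *)
Definition string_coef i : F := ((d - i)`!)%:R / (d`!)%:R.

Definition string_fun (w : W) (v : 'rV[F]_d.+1) : M :=
  \sum_(i < d.+1) v 0 i *: (string_coef i *: iter i E (phi w)).

Lemma iterE_linear i : linear (fun w => iter i E (phi w)).
Proof.
move=> a u v; rewrite linearP.
by elim: i => //= i ->; rewrite linearP.
Qed.

Lemma string_fun_linearl v : linear (string_fun^~ v).
Proof.
move=> a u w; rewrite /string_fun scaler_sumr -big_split; apply: eq_bigr => i _.
rewrite iterE_linear /= !scalerDr !scalerA; congr (_ *: _ + _).
by rewrite mulrC mulrA.
Qed.

Lemma string_fun_linearr w : linear (string_fun w).
Proof.
move=> a u v; rewrite /string_fun scaler_sumr -big_split; apply: eq_bigr => i _.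
by rewrite !mxE scalerDl !scalerA mulrA.
Qed.

Definition string_map : 'Hom(sl2_tensor W (sl2_irr F d), M) :=
  tens_lift string_fun.

Lemma string_mapE w i : (i <= d)%N ->
  string_map (tens w (irr_vec F d i)) = string_coef i *: iter i E (phi w).
Proof.
move=> id; have -> : string_map (tens w (irr_vec F d i)) =
    string_fun w (irr_vec F d i).
  by apply: tens_liftE; [exact: string_fun_linearl|exact: string_fun_linearr].
rewrite /string_fun (bigD1 (Ordinal (id : (i < d.+1)%N))) //= mxE eqxx scale1r.
rewrite big1 ?addr0 // => j /negPf ji.
by rewrite mxE (_ : (j == i :> nat) = false) ?scale0r.
Qed.

Definition irr_coord i : 'Hom(tensor W (sl2_irr F d), W) :=
  tens_lift (fun w (v : 'rV[F]_d.+1) => v 0 i *: w).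

Lemma tens_irr_decomp (X : tensor W (sl2_irr F d)) :
  X = \sum_(i < d.+1) tens (irr_coord i X) (irr_vec F d i).
Proof.
pose h (Y : tensor W (sl2_irr F d)) : tensor W (sl2_irr F d) :=
  \sum_(i < d.+1) tens (irr_coord i Y) (irr_vec F d i).
have lh : linear h.
  move=> a Y Z; rewrite /h scaler_sumr -big_split; apply: eq_bigr => i _.
  by rewrite linearP tensDl.
pose h' : {linear tensor W (sl2_irr F d) -> tensor W (sl2_irr F d)} :=
  HB.pack h (GRing.isLinear.Build _ _ _ _ _ lh).
suff /(congr1 (fun f : 'End(_) => f X)) : \1%VF = linfun h'.
  by rewrite id_lfunE lfunE.
apply: eq_tens => w v; rewrite id_lfunE lfunE /= /h.
have tensZl a w' (v' : sl2_irr F d) : tens (a *: w') v' = a *: tens w' v'.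
  by apply/matrixP => i j; rewrite !mxE linearZ /= mulrA.
have coordE i : irr_coord i (tens w v) = (v : 'rV_d.+1) 0 i *: w.
  apply: tens_liftE => [u a x y|x a u u'].
    by rewrite scalerDr !scalerA mulrC.
  by rewrite !mxE scalerDl scalerA.
under eq_bigr do rewrite coordE tensZl.
apply/matrixP => i j; rewrite summxE mxE.
under eq_bigr do rewrite !mxE mulrCA.
rewrite -mulr_sumr; congr (_ * _).
rewrite {1}(_ : v = \sum_(k < d.+1) (v : 'rV_d.+1) 0 k *: irr_vec F d k).
  by rewrite linear_sum; apply: eq_bigr => l _; rewrite linearZ.
rewrite [LHS]row_sum_delta; apply: eq_bigr => l _; congr (_ *: _).
by apply/rowP => p; rewrite !mxE eqxx.
Qed.

Lemma string_map_sum X : string_map X =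
  \sum_(i < d.+1) string_coef i *: iter i E (phi (irr_coord i X)).
Proof.
rewrite {1}[X]tens_irr_decomp linear_sum; apply: eq_bigr => i _.
by apply: string_mapE; rewrite -ltnS.
Qed.

Lemma string_coef_neq0 i : string_coef i != 0.
Proof. by rewrite mulf_neq0 ?invr_eq0 // natr_eq0 -lt0n fact_gt0. Qed.

(** Terms e_+^i w_i have different weights, hence vanish separately, and
    e_-^i recovers a nonzero multiple of w_i. *)
Lemma string_map_inj : injective string_map.
Proof.
apply/lker0P; rewrite -subv0; apply/subvP => X.
rewrite memv_ker memv0 string_map_sum => /eqP s0.
suff w0 (i : 'I_d.+1) : irr_coord i X = 0.
  rewrite [X]tens_irr_decomp big1 // => i _; rewrite w0.
  by apply/matrixP => p q; rewrite !mxE linear0 mul0r.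
have /eqP : string_coef i *: iter i E (phi (irr_coord i X)) = 0.
  apply: (@eigenvectors_free F M H _ (index_enum 'I_d.+1)
    (fun i : 'I_d.+1 => weight (k + i))
    (fun i : 'I_d.+1 => string_coef i *: iter i E (phi (irr_coord i X)))) => //.
  - by move=> a x y; rewrite linearP.
  - exact: index_enum_uniq.
  - by move=> p q _ _ /weight_inj /addnI/val_inj.
  - move=> p _; rewrite linearZ /= (has_weight_iterE p (phiP _).2).
    by rewrite !scalerA mulrC.
rewrite scaler_eq0 (negPf (string_coef_neq0 i)) /= => /eqP Ei.
have [|c c0] := @lowest_iterD_iterE k i _ (phiP (irr_coord i X)).
  by have := ltn_ord i; rewrite /d; lia.
rewrite Ei (_ : iter i D 0 = 0); last first.
  by elim: (i : nat) => //= p ->; rewrite linear0.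
move/esym/eqP; rewrite scaler_eq0 (negPf c0) /= => /eqP p0.
by apply: phi_inj; rewrite p0 linear0.
Qed.

Lemma casimir_string_map X :
  casimir (string_map X) = (d * (d + 2))%:R *: string_map X.
Proof.
rewrite string_map_sum linear_sum scaler_sumr; apply: eq_bigr => i _.
by rewrite linearZ /= (casimir_string i (phiP _) km) !scalerA mulrC.
Qed.

Lemma sl2_tensor_rhoE (N : sl2Module F) x w (v : N) :
  sl2_rho (sl2_tensor W N) x (tens w v) = tens w (sl2_rho N x v).
Proof.
have -> : sl2_rho (sl2_tensor W N) x = sl2_tensor_act W N x by exact: lfunE.
exact: sl2_tensor_actE.
Qed.

Lemma string_map_equivariant : sl2_equivariant string_map.
Proof.
have red (x : subvs_of (sl2_space F)) :
   (forall w i, (i <= d)%N ->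
       string_map (tens w (sl2_rho (sl2_irr F d) x (irr_vec F d i))) =
       sl2_rho M x (string_coef i *: iter i E (phi w))) ->
   forall X, string_map (sl2_rho (sl2_tensor W (sl2_irr F d)) x X) =
      sl2_rho M x (string_map X).
  move=> hx X; rewrite {1}[X]tens_irr_decomp [in RHS]string_map_sum !linear_sum.
  apply: eq_bigr => i _; apply: etrans (hx (irr_coord i X) i (ltn_ord i)).
  by congr (string_map _); apply: sl2_tensor_rhoE.
have tensZr a w (v : sl2_irr F d) : tens w (a *: v) = a *: tens w v.
  by apply/matrixP => i j; rewrite !mxE linearZ /= mulrCA.
have sZ a X : string_map (a *: X) = a *: string_map X by exact: linearZ.
have [e1 e2 e3] := sl2_of_tripleE (@irr_HE F d) (@irr_HD F d) (@irr_ED F d).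
apply: sl2_equivariant_gen; apply: red => w i id; rewrite ?(e1, e2, e3).
- rewrite irr_e_plusE // tensZr sZ linearZ /=.
  have [ltid|] := ltnP i d; last first.
    move=> le; have -> : i = d by apply/eqP; rewrite eqn_leq id.
    rewrite subnn scale0r -[E _]/(iter d.+1 E (phi w)).
    by rewrite (lowest_string_end (phiP w) km) scaler0.
  rewrite string_mapE // scalerA; congr (_ *: _).
  by rewrite /string_coef mulrA -natrM -{2}(subnSK ltid) factS subnSK.
- rewrite irr_e_minusE // tensZr sZ linearZ /=.
  case: i id => [|i] id; first by rewrite scale0r /= (phiP w).1 scaler0.
  rewrite string_mapE ?(ltnW id) // (lowest_D_iterE _ (phiP w)) !scalerA.
  congr (_ *: _); rewrite /string_coef.
  rewrite (_ : m%:R - 2%:R * k%:R - i%:R = (d - i)%:R); last first.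
    by rewrite natrB ?(ltnW id) // natrB // natrM.
  rewrite -(subnSK id) factS natrM; ring.
- rewrite irr_hE // tensZr sZ linearZ /= string_mapE //.
  rewrite (has_weight_iterE i (phiP w).2) !scalerA mulrC; congr (_ * _ *: _).
  by rewrite /weight natrB // natrM natrD; ring.
Qed.

End String.

(** The spaces W k stand for the lowest weight spaces of M, to which phi
    identifies them; this allows Specht modules to be substituted directly. *)
Theorem weight_module_decomp (W : nat -> vectType F)
    (phi : forall k, 'Hom(W k, M)) :
  (forall k, (2 * k <= m)%N -> injective (phi k)) ->
  (forall k, (2 * k <= m)%N -> forall v, v \in limg (phi k) <-> lowest k v) ->
  sl2_isomorphic M (\big[@sl2_sum F / sl2_zero F]_(0 <= k < (m %/ 2).+1)
    sl2_tensor (W k) (sl2_irr F (m - 2 * k)%N)).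
Proof.
move=> phi_inj phiP.
have lowP k (km : (2 * k <= m)%N) w : lowest k (phi k w).
  by apply/(phiP k km)/memv_img/memvf.
have bound k : k \in index_iota 0 (m %/ 2).+1 -> (2 * k <= m)%N.
  by rewrite mem_index_iota; lia.
pose U k := limg (string_map k (phi k)).
apply: (@sl2_isomorphic_bigsum F M _ _ _ (fun k => string_map k (phi k))).
- exact: iota_uniq.
- by move=> k /bound km; apply: string_map_equivariant (lowP k km).
- by move=> k /bound km; apply: string_map_inj (phi_inj k km) (lowP k km).
- move=> u uU u0.
  apply: (@eigenvectors_free F M casimir _ _
            (fun k => ((m - 2 * k) * (m - 2 * k + 2))%:R)) u0.
  + by move=> a x y; rewrite linearP.
  + exact: iota_uniq.
  + by move=> k l /bound km /bound lm /natr_inj; nia.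
  + move=> k kr; have /memv_imgP[X _ ->] := uU k kr.
    by rewrite (casimir_string_map (bound k kr) (lowP k (bound k kr))).
pose N := (\sum_(k < (m %/ 2).+1) U k)%VS.
have Nrho x v : v \in N -> sl2_rho M x v \in N.
  move=> /memv_sumP[u uU ->]; rewrite linear_sum; apply: memv_sumr => k _.
  have /memv_imgP[X _ ->] := uU k isT.
  have km : (2 * k <= m)%N by have := ltn_ord k; lia.
  by rewrite /= -(string_map_equivariant km (lowP k km)); apply/memv_img/memvf.
move=> v.
have : v \in N.
  apply: generated_by_lowest (Nrho _) (Nrho _) _ v => k u km lu.
  have /phiP-/(_ km)/memv_imgP[w _ ->] := lu.
  have kr : (k < (m %/ 2).+1)%N by lia.
  apply: (subvP (sumv_sup (Ordinal kr) isT (subvv _))).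
  have -> : phi k w = string_map k (phi k) (tens w (irr_vec F _ 0)).
    by rewrite string_mapE //= /string_coef subn0 divff ?scale1r //
       natr_eq0 -lt0n fact_gt0.
  exact/memv_img/memvf.
move=> /memv_sumP[u uU ->].
exists (fun k => if insub k is Some i then u i else 0).
  move=> k; rewrite mem_index_iota => kr.
  by rewrite (insubT (fun k => (k < _)%N) kr); apply: (uU (Ordinal kr)).
by rewrite big_mkord; apply: eq_bigr => k _; rewrite valK.
Qed.

End WeightModule.

(** * The kernel of D_- in the graph algebra *)

Section Kernel.
Variables (F : fieldType) (m : nat).
Local Notation A := (galg F m).
Local Notation x_ := (@gmon F m).
Local Notation D := (gD_minus F m).
Implicit Types (e f : 'I_m) (S U : {set 'I_m}) (v w a : A).

(** The operators [gcreate] and [gannih] generate an algebra in which D_- is the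
    sum of the gannih e and the degree is the sum of the gcreate e o gannih e.
    Killing the x_S with e in S, rather than fixing them as multiplication by
    x_e does, is what makes the anticommutation rule [gannih_create] hold. *)
Definition gcreate e : 'End(A) :=
  glin (fun S => if e \in S then 0 else x_ (e |: S)).
Definition gannih e : 'End(A) :=
  glin (fun S => if e \in S then x_ (S :\ e) else 0).
Definition gdegree : 'End(A) := glin (fun S => #|S|%:R *: x_ S).

Local Notation X := gcreate.
Local Notation d := gannih.
Local Notation N := gdegree.

Lemma gcreateE e S : X e (x_ S) = if e \in S then 0 else x_ (e |: S).
Proof. exact: glinE. Qed.
Lemma gannihE e S : d e (x_ S) = if e \in S then x_ (S :\ e) else 0.
Proof. exact: glinE. Qed.
Lemma gdegreeE S : N (x_ S) = #|S|%:R *: x_ S.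
Proof. exact: glinE. Qed.

Lemma eq_galg (g h : 'End(A)) v : (forall S, g (x_ S) = h (x_ S)) -> g v = h v.
Proof. by move=> /eq_gmon ->. Qed.

Lemma gannih_create e v : d e (X e v) = v - X e (d e v).
Proof.
suff : ((d e \o X e) + (X e \o d e))%VF v = \1%VF v.
  rewrite add_lfunE !comp_lfunE id_lfunE => h.
  by apply: (addIr (X e (d e v))); rewrite subrK.
apply: eq_galg => S; rewrite add_lfunE !comp_lfunE id_lfunE gcreateE gannihE.
case: ifPn => eS.
  by rewrite linear0 add0r gcreateE !inE eqxx /= setD1K.
by rewrite linear0 addr0 gannihE setU11 setU1K.
Qed.

Lemma gannih_createC e f v : e != f -> d e (X f v) = X f (d e v).
Proof.
move=> ef; rewrite -!comp_lfunE; apply: eq_galg => S.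
rewrite !comp_lfunE gcreateE gannihE; case: (ifPn (f \in S)) => fS.
  rewrite linear0; case: ifPn => eS; last by rewrite linear0.
  by rewrite gcreateE !inE eq_sym ef fS.
rewrite gannihE !inE (negPf ef) /=; case: ifPn => eS; last by rewrite linear0.
rewrite gcreateE !inE eq_sym ef (negPf fS); congr x_; apply/setP => g.
by rewrite !inE; case: (eqVneq g f) => [->|]; rewrite ?andbT // eq_sym ef.
Qed.

Lemma gannih2 e v : d e (d e v) = 0.
Proof.
have -> : 0 = (0 : 'End(A)) v by rewrite zero_lfunE.
rewrite -comp_lfunE; apply: eq_galg => S; rewrite comp_lfunE zero_lfunE gannihE.
by case: ifPn => eS; rewrite ?linear0 // gannihE !inE eqxx.
Qed.

Lemma gannihC e f v : d e (d f v) = d f (d e v).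
Proof.
have [->//|ef] := eqVneq e f.
rewrite -!comp_lfunE; apply: eq_galg => S; rewrite !comp_lfunE !gannihE.
case: (ifPn (f \in S)) => fS; case: (ifPn (e \in S)) => eS;
  rewrite ?linear0 ?gannihE //.
- by rewrite !inE ef eS eq_sym ef fS /= !setDDl setUC.
- by rewrite !inE (negPf eS) andbF.
- by rewrite !inE (negPf fS) andbF.
Qed.

Lemma gD_minus_sum v : D v = \sum_e d e v.
Proof.
rewrite -sum_lfunE; apply: eq_galg => S; rewrite gD_minusE sum_lfunE big_mkcond.
by apply: eq_bigr => e _; rewrite gannihE.
Qed.

Lemma gdegree_sum v : N v = \sum_e X e (d e v).
Proof.
under eq_bigr do rewrite -comp_lfunE.
rewrite -sum_lfunE; apply: eq_galg => S; rewrite gdegreeE sum_lfunE.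
rewrite scaler_nat -sumr_const big_mkcond; apply: eq_bigr => e _.
rewrite comp_lfunE gannihE; case: ifPn => eS; last by rewrite linear0.
by rewrite gcreateE !inE eqxx /= setD1K.
Qed.

Lemma gD_zero_degree v : gD_zero F m v = 2%:R *: N v - m%:R *: v.
Proof.
have -> : 2%:R *: N v - m%:R *: v = (2%:R *: N - m%:R *: \1%VF) v.
  by rewrite add_lfunE opp_lfunE !scale_lfunE id_lfunE.
apply: eq_galg => S; rewrite add_lfunE opp_lfunE !scale_lfunE id_lfunE.
by rewrite gD_zeroE gdegreeE scalerA -scalerBl opprB.
Qed.

Lemma gD_minus_annih e v : D (d e v) = d e (D v).
Proof.
by rewrite !gD_minus_sum linear_sum; apply: eq_bigr => f _; apply: gannihC.
Qed.

Lemma gD_minus_create e v : d e v = 0 -> D (X e v) = X e (D v) + v.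
Proof.
move=> ev; rewrite !gD_minus_sum (bigD1 e) //= [in RHS](bigD1 e) //=.
rewrite gannih_create ev linear0 subr0 add0r addrC linear_sum; congr (_ + _).
by apply: eq_bigr => f fe; rewrite gannih_createC.
Qed.

Lemma gdegree_create e v : N (X e v) = X e (N v) + X e v.
Proof.
have -> : X e (N v) + X e v = ((X e \o N) + X e)%VF v.
  by rewrite add_lfunE comp_lfunE.
rewrite -comp_lfunE; apply: eq_galg => S.
rewrite add_lfunE !comp_lfunE gdegreeE linearZ /= gcreateE.
case: ifPn => eS; first by rewrite linear0 scaler0 addr0.
by rewrite gdegreeE cardsU1 eS -{3}[x_ (e |: S)]scale1r -scalerDl natrD addrC.
Qed.

Lemma gdegree_annih e v : N (d e v) = d e (N v) - d e v.
Proof.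
have -> : d e (N v) - d e v = ((d e \o N) - d e)%VF v.
  by rewrite add_lfunE opp_lfunE comp_lfunE.
rewrite -comp_lfunE; apply: eq_galg => S.
rewrite add_lfunE opp_lfunE !comp_lfunE gdegreeE linearZ /= gannihE.
case: ifPn => eS; last by rewrite linear0 scaler0 subr0.
rewrite gdegreeE (cardsD1 e S) eS -{3}[x_ (S :\ e)]scale1r -scalerBl natrD.
by rewrite addrAC subrr add0r.
Qed.

Definition of_degree k v := N v = k%:R *: v.
(** Since gannih e is the formal derivative along x_e, only the variables in U
    occur in v. *)
Definition supported U v := forall e, e \notin U -> d e v = 0.

Lemma of_degree_annih k e v : of_degree k.+1 v -> of_degree k (d e v).
Proof.
rewrite /of_degree gdegree_annih => ->; rewrite linearZ /= -natr1 scalerDl.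
by rewrite scale1r addrK.
Qed.

Lemma of_degree_create k e v : of_degree k v -> of_degree k.+1 (X e v).
Proof.
rewrite /of_degree gdegree_create => ->; rewrite linearZ /= -natr1 scalerDl.
by rewrite scale1r.
Qed.

Lemma of_degreeB k v w : of_degree k v -> of_degree k w -> of_degree k (v - w).
Proof. by rewrite /of_degree linearB scalerBr /= => -> ->. Qed.

Lemma supported_annih U e v : supported U v -> supported (U :\ e) (d e v).
Proof.
move=> Uv f; rewrite !inE negb_and negbK => /orP[/eqP ->|/Uv fv].
  exact: gannih2.
by rewrite gannihC fv linear0.
Qed.

Lemma supported_remove U e v : supported U v -> d e v = 0 ->
  supported (U :\ e) v.
Proof.
by move=> Uv ev f; rewrite !inE negb_and negbK => /orP[/eqP ->|/Uv].
Qed.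

Lemma iter_gD_minus_annih j e v : iter j D (d e v) = d e (iter j D v).
Proof. by elim: j => //= j ->; rewrite gD_minus_annih. Qed.

Lemma iter_gD_minus_create j e v : d e v = 0 ->
  iter j.+1 D (X e v) = X e (iter j.+1 D v) + j.+1%:R *: iter j D v.
Proof.
move=> ev; elim: j => [|j IH].
  by rewrite /= gD_minus_create // scale1r.
rewrite iterS IH linearD linearZ /= -!iterS gD_minus_create; last first.
  by rewrite -iter_gD_minus_annih ev; elim: j.+1 => //= i ->; rewrite linear0.
by rewrite -addrA -[j.+2%:R]nat1r scalerDl scale1r.
Qed.

Hypothesis pchar0 : [pchar F] =i pred0.

Let natr_eq0 n : (n%:R == 0 :> F) = (n == 0%N).
Proof. exact: (pcharf0P F).1. Qed.

Let natZ_eq0 (V : vectType F) n (v : V) : n.+1%:R *: v = 0 -> v = 0.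
Proof. by move/eqP; rewrite scaler_eq0 natr_eq0 => /eqP. Qed.

(** Induction on #|U|. Write v = x_e a + b with e in U. Then D_-^j kills a, hence
    D_-^(j+1) kills b, and b = 0 because it has one variable less. What remains
    of D_-^j v = 0 is j D_-^(j-1) a = 0, which gives a = 0. Allowing all j rather
    than j = 1 is what lets b fall under the induction hypothesis. *)
Lemma iter_gD_minus_inj U j k v : of_degree k v -> supported U v ->
  (j + #|U| <= 2 * k)%N -> iter j D v = 0 -> v = 0.
Proof.
have it0 i : iter i D 0 = 0 by elim: i => //= i ->; rewrite linear0.
have [n] := ubnP #|U|; elim: n U j k v => // n IH U [|j] k v //.
rewrite ltnS => Un kv Uv le jv.
case: k => [|k] in kv le *; first lia.
have [U0|[e eU]] := set_0Vmem U.
  apply: (@natZ_eq0 _ k); rewrite -[LHS]kv gdegree_sum big1 // => e _.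
  by rewrite Uv ?linear0 // U0 inE.
have cU : #|U| = #|U :\ e|.+1 by rewrite (cardsD1 e U) eU.
set a := d e v.
have ka : of_degree k a by apply: of_degree_annih.
have Ua : supported (U :\ e) a by apply: supported_annih.
have ea : d e a = 0 by apply: gannih2.
have ja : iter j.+1 D a = 0 by rewrite iter_gD_minus_annih jv linear0.
(* The difference v - x_e a is free of e and killed by D_-^(j+2). *)
have vE : v = X e a.
  apply/eqP; rewrite -subr_eq0; apply/eqP.
  apply: (IH (U :\ e) j.+2 k.+1); [lia| | |lia|].
  - by apply: of_degreeB => //; apply: of_degree_create.
  - apply: supported_remove => [f fU|].
      rewrite linearB /= Uv // gannih_createC; last by apply: contraNneq fU => ->.
      have -> : d f a = 0 by apply: Ua; rewrite !inE negb_and fU orbT.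
      by rewrite linear0 subrr.
    by rewrite linearB /= gannih_create ea linear0 subr0 subrr.
  - have iB i (y z : A) : iter i D (y - z) = iter i D y - iter i D z.
      by elim: i => //= i ->; rewrite linearB.
    rewrite iB iter_gD_minus_create // iterS jv linear0 (iterS j.+1) ja.
    by rewrite !linear0 addr0 subr0.
suff a0 : a = 0 by rewrite vE a0 linear0.
apply: (IH (U :\ e) j k) => //; try lia.
move: jv; rewrite {1}vE iter_gD_minus_create // ja linear0 add0r.
exact: natZ_eq0.
Qed.

(** The product of the differences x_b - x_a over the pairs (a, b), written
    with the operators [gcreate]; it is the honest product when the entries are
    distinct. *)
Definition pairprod (ps : seq ('I_m * 'I_m)) : A :=
  foldr (fun p w => X p.2 w - X p.1 w) (x_ set0) ps.

Definition pair_entries (ps : seq ('I_m * 'I_m)) : seq 'I_m :=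
  flatten [seq [:: p.1; p.2] | p <- ps].

Lemma pairprod_supported ps e : e \notin pair_entries ps -> d e (pairprod ps) = 0.
Proof.
elim: ps => [_|p ps IH] /=; first by rewrite gannihE inE.
rewrite !inE !negb_or => /and3P[e1 e2 /IH eps].
by rewrite linearB /= !gannih_createC // eps !linear0 addr0.
Qed.

Lemma pairprod_degree ps : of_degree (size ps) (pairprod ps).
Proof.
elim: ps => [|p ps IH] /=; last by apply: of_degreeB; apply: of_degree_create.
by rewrite /of_degree gdegreeE cards0.
Qed.

Lemma gD_minus_pairprod ps : uniq (pair_entries ps) -> D (pairprod ps) = 0.
Proof.
elim: ps => [_|p ps IH] /=; first by rewrite gD_minusE big_set0.
rewrite inE negb_or => /and3P[/andP[_ p1] p2 /IH D0].
rewrite linearB /= !gD_minus_create ?pairprod_supported // D0.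
by rewrite !linear0 subrr.
Qed.

Definition pair_family (U : {set 'I_m}) (ps : seq ('I_m * 'I_m)) :=
  uniq (pair_entries ps) && all (mem U) (pair_entries ps).

Definition pairspan k U : {vspace A} :=
  span [seq pairprod (tval ps) | ps <- enum [pred ps : k.-tuple ('I_m * 'I_m) |
     pair_family U ps]].

Lemma mem_pairspan U ps : pair_family U ps -> pairprod ps \in pairspan (size ps) U.
Proof.
move=> Ups; apply: memv_span; apply/mapP; exists (in_tuple ps) => //.
by rewrite mem_enum inE.
Qed.

Lemma pairspan_ind k U (W : {vspace A}) :
  (forall ps, size ps = k -> pair_family U ps -> pairprod ps \in W) ->
  (pairspan k U <= W)%VS.
Proof.
move=> h; apply/span_subvP => _ /mapP[ps psU ->]; apply: h.
  exact: size_tuple.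
by move: psU; rewrite mem_enum inE.
Qed.

Lemma size_pair_entries ps : size (pair_entries ps) = (2 * size ps)%N.
Proof. by elim: ps => //= p ps ->; rewrite mulnS. Qed.

Lemma pairspan_sub k U v : v \in pairspan k U ->
  [/\ of_degree k v, supported U v & D v = 0].
Proof.
move=> vU; split.
- suff /subvP/(_ v vU) : (pairspan k U <= lker (N - k%:R *: \1%VF))%VS.
    move/eqlfunP; by rewrite scale_lfunE id_lfunE.
  apply: pairspan_ind => ps <- _; apply/eqlfunP.
  rewrite scale_lfunE id_lfunE; exact: pairprod_degree.
- move=> e eU; suff /subvP/(_ v vU) : (pairspan k U <= lker (d e))%VS.
    by rewrite memv_ker => /eqP.
  apply: pairspan_ind => ps _ /andP[_ /allP psU]; rewrite memv_ker.
  by rewrite pairprod_supported //; apply: contra eU => /psU.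
- suff /subvP/(_ v vU) : (pairspan k U <= lker D)%VS.
    by rewrite memv_ker => /eqP.
  apply: pairspan_ind => ps _ /andP[ups _]; rewrite memv_ker.
  by rewrite gD_minus_pairprod.
Qed.

(** The coordinate of v at S is multiplied by #|S|, so only S = set0 survives. *)
Lemma of_degree0 v : of_degree 0 v -> v \in <[x_ set0]>%VS.
Proof.
rewrite /of_degree scale0r => v0.
suff -> : v = gcoord v set0 *: x_ set0 by rewrite memvZ // memv_line.
rewrite {1}[v]gcoordE (bigD1 set0) //= big1 ?addr0 // => S S0.
have : gcoord (N v) S = #|S|%:R * gcoord v S.
  have -> : N v = \sum_S [ffun T : {set 'I_m} => #|T|%:R * gcoord v T] S *: x_ S.
    rewrite {1}[v]gcoordE linear_sum; apply: eq_bigr => T _.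
    by rewrite linearZ /= gdegreeE ffunE scalerA mulrC.
  by rewrite gcoord_sum ffunE.
have -> : gcoord (N v) S = 0.
  by rewrite v0 -(addNr v) -scaleN1r gcoordP mulN1r addNr.
move/esym/eqP.
rewrite mulf_eq0 natr_eq0 cards_eq0 (negPf S0) /= => /eqP ->.
by rewrite scale0r.
Qed.

(** When 2k > #|U| the kernel is zero. Otherwise write v = x_e a + b with e in U;
    by induction a lies in the span for U :\ e. Each product of k - 1 differences
    there misses some c in U :\ e, since 2(k - 1) < #|U| - 1, and is the derivative
    along x_e of its product with x_e - x_c. So some w in the span for U has the
    same derivative a as v, and v - w involves only the variables in U :\ e. *)
Lemma ker_gD_minus_span U k v : of_degree k v -> supported U v -> D v = 0 ->
  v \in pairspan k U.
Proof.
have [n] := ubnP #|U|; elim: n U k v => // n IH U [|k] v;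
  rewrite ltnS => Un kv Uv Dv.
  have /vlineP[c ->] := of_degree0 kv; apply: memvZ.
  exact: (@mem_pairspan U [::]).
have [le|lt] := leqP (1 + #|U|) (2 * k.+1).
  by rewrite (iter_gD_minus_inj kv Uv le) ?mem0v.
have [U0|[e eU]] := set_0Vmem U; first by move: lt; rewrite U0 cards0; lia.
have cU : #|U| = #|U :\ e|.+1 by rewrite (cardsD1 e U) eU.
have da : d e v \in pairspan k (U :\ e).
  apply: IH; first lia.
  - exact: of_degree_annih.
  - exact: supported_annih.
  - by rewrite gD_minus_annih Dv linear0.
have lift : (pairspan k (U :\ e) <= d e @: pairspan k.+1 U)%VS.
  apply: pairspan_ind => ps sps /andP[ups /allP psU].
  have [c] : exists c, c \in (U :\ e) :\: [set f in pair_entries ps].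
    apply/set0Pn; rewrite -card_gt0.
    have := cardsD (U :\ e) [set f in pair_entries ps].
    have : (#|(U :\ e) :&: [set f in pair_entries ps]| <= 2 * k)%N.
      apply: leq_trans (subset_leq_card (subsetIr _ _)) _.
      by rewrite cardsE -sps -size_pair_entries card_size.
    lia.
  rewrite !inE => /and3P[cps ce cU'].
  have eps : e \notin pair_entries ps.
    by apply/negP => /psU; rewrite !inE eqxx.
  have -> : pairprod ps = d e (pairprod ((c, e) :: ps)).
    rewrite /= linearB /= gannih_create gannih_createC 1?eq_sym //.
    by rewrite pairprod_supported // linear0 subr0 linear0 subr0.
  apply: memv_img; rewrite -sps; apply: (@mem_pairspan U ((c, e) :: ps)).
  rewrite /pair_family /= inE negb_or ce cps eps ups cU' eU /=.
  by apply/allP => f /psU; rewrite !inE => /andP[].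
have /memv_imgP[w wU dw] := subvP lift _ da.
have [kw Uw Dw] := pairspan_sub wU.
rewrite -(subrK w v) rpredD //.
have: v - w \in pairspan k.+1 (U :\ e).
  apply: IH; first lia.
  - exact: of_degreeB.
  - apply: supported_remove => [f fU|]; first by rewrite linearB /= Uv ?Uw ?subrr.
    by rewrite linearB /= dw subrr.
  - by rewrite linearB /= Dv Dw subrr.
apply/subvP; apply: pairspan_ind => ps <- /andP[ups /allP psU].
apply: mem_pairspan; rewrite /pair_family ups /=.
by apply/allP => f /psU; rewrite !inE => /andP[].
Qed.

End Kernel.

(** * Polytabloids of two-row shape as signed sums *)

Section PairStab.
Variables (F : fieldType) (m : nat).
Local Notation x_ := (@gmon F m).
Implicit Types (ps : seq ('I_m * 'I_m)) (s : 'S_m) (e f : 'I_m).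

Definition pair_rel ps e f := [|| f == e, (e, f) \in ps | (f, e) \in ps].

Definition pair_stab ps : {set 'S_m} :=
  [set s : 'S_m | [forall e, pair_rel ps e (s e)]].

Lemma pair_stabP ps s :
  reflect (forall e, pair_rel ps e (s e)) (s \in pair_stab ps).
Proof. by rewrite inE; apply: forallP. Qed.

Lemma perm_pair_entries ps :
  perm_eq (pair_entries ps) (unzip1 ps ++ unzip2 ps).
Proof.
elim: ps => //= p ps IH; rewrite perm_cons perm_sym.
rewrite -[p.2 :: unzip2 ps]cat1s perm_catCA /=.
by rewrite perm_cons perm_sym.
Qed.

Lemma notin_pair_entries ps e f : e \notin pair_entries ps ->
  ((e, f) \in ps) = false /\ ((f, e) \in ps) = false.
Proof.
rewrite (perm_mem (perm_pair_entries ps)) mem_cat negb_or => /andP[e1 e2].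
by split; apply/negP => /(map_f _) h; [move: (e1)|move: (e2)]; rewrite h.
Qed.

Lemma pair_rel_notin ps e f : e \notin pair_entries ps ->
  pair_rel ps e f = (f == e).
Proof.
by move=> eps; have [h1 h2] := notin_pair_entries f eps; rewrite /pair_rel h1 h2 !orbF.
Qed.

Lemma pair_rel_cons a b ps e f :
  pair_rel ((a, b) :: ps) e f =
  [|| pair_rel ps e f, (e == a) && (f == b) | (f == a) && (e == b)].
Proof.
rewrite /pair_rel !inE !xpair_eqE.
by case: (f == e); case: (_ \in ps); case: (_ \in ps); case: (_ && _); case: (_ && _).
Qed.

Section Cons.
Variables (a b : 'I_m) (ps : seq ('I_m * 'I_m)).
Hypotheses (ab : a != b) (aps : a \notin pair_entries ps)
  (bps : b \notin pair_entries ps).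

Lemma pair_stab_cons_fix s :
  (s \in pair_stab ((a, b) :: ps)) && (s a == a) = (s \in pair_stab ps).
Proof.
apply/andP/pair_stabP => [[/pair_stabP h /eqP sa] e|h].
  have [->|ea] := eqVneq e a; first by rewrite /pair_rel sa eqxx.
  have := h e; rewrite pair_rel_cons (negPf ea) /= -[X in (_ == X) && _]sa.
  by rewrite (inj_eq perm_inj) (negPf ea) orbF.
split; last by have := h a; rewrite pair_rel_notin.
by apply/pair_stabP => e; rewrite pair_rel_cons h.
Qed.

Lemma pair_stab_cons_move s :
  ((tperm a b * s)%g \in pair_stab ((a, b) :: ps)) && ((tperm a b * s)%g a != a)
  = (s \in pair_stab ps).
Proof.
rewrite permM tpermL; apply/andP/pair_stabP => [[/pair_stabP h sba] e|h].
  have ba : (b == a) = false by rewrite eq_sym (negPf ab).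
  have sb : s b = b.
    have := h a; rewrite permM tpermL pair_rel_cons pair_rel_notin //.
    by rewrite (negPf sba) eqxx /= orbF => /eqP.
  have sa : s a = a.
    have := h b; rewrite permM tpermR pair_rel_cons pair_rel_notin // ba /= eqxx.
    by rewrite -{1}sb (inj_eq perm_inj) (negPf ab) andbT => /eqP.
  have [->|ea] := eqVneq e a; first by rewrite /pair_rel sa eqxx.
  have [->|eb] := eqVneq e b; first by rewrite /pair_rel sb eqxx.
  have := h e; rewrite permM tpermD 1?eq_sym // pair_rel_cons.
  by rewrite (negPf ea) (negPf eb) andbF !orbF.
have sa : s a = a by have := h a; rewrite pair_rel_notin // => /eqP.
have sb : s b = b by have := h b; rewrite pair_rel_notin // => /eqP.
split; last by rewrite sb eq_sym.
apply/pair_stabP => e; rewrite permM pair_rel_cons.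
have [->|ea] := eqVneq e a; first by rewrite tpermL sb eqxx orbT.
have [->|eb] := eqVneq e b; first by rewrite tpermR sa eqxx !orbT.
by rewrite tpermD 1?eq_sym // h.
Qed.

End Cons.

(** Expanding the product: the stabiliser of the pairs (a, b) :: ps is the disjoint
    union of that of ps and its translate by the transposition of a and b, which
    changes the sign and replaces b by a in the monomial. *)
Lemma pairprod_signed_sum ps : uniq (pair_entries ps) ->
  pairprod F ps = \sum_(s in pair_stab ps)
    (-1) ^+ s *: x_ (s @: [set e in unzip2 ps]).
Proof.
elim: ps => [_|[a b] ps IH /=].
  rewrite (bigD1 1%g) /=; last by apply/pair_stabP => e; rewrite /pair_rel perm1 eqxx.
  rewrite odd_perm1 scale1r big1 ?addr0 => [|s /andP[/pair_stabP h /eqP[]]].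
    by congr x_; apply/setP => e; rewrite inE; apply/esym/imsetP => -[f]; rewrite inE.
  by apply/permP => e; rewrite perm1; have := h e; rewrite pair_rel_notin // => /eqP.
rewrite inE negb_or => /and3P[/andP[ab aps] bps ups].
have fixab s : s \in pair_stab ps -> s a = a /\ s b = b.
  move=> /pair_stabP h; have := h a; have := h b.
  by rewrite !pair_rel_notin // => /eqP-> /eqP->.
pose B := [set e in unzip2 ps].
have notinB e : e \notin pair_entries ps -> e \notin B.
  by rewrite (perm_mem (perm_pair_entries ps)) mem_cat negb_or inE => /andP[].
have -> : [set e in b :: unzip2 ps] = b |: B by apply/setP => e; rewrite !inE.
rewrite (bigID (fun s : 'S_m => s a == a)) /=; congr (_ + _).
  rewrite IH // linear_sum; apply: eq_big => s; first by rewrite pair_stab_cons_fix.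
  move=> sps; have [sa sb] := fixab s sps.
  rewrite linearZ /= gcreateE imsetU1 sb ifN // -{1}sb mem_imset ?notinB //.
  exact: perm_inj.
rewrite (reindex_inj (mulgI (tperm a b))) IH // linear_sum -sumrN.
apply: eq_big => s; first by rewrite pair_stab_cons_move.
move=> sps; have [sa sb] := fixab s sps.
rewrite linearZ /= gcreateE -{1}sa mem_imset; last exact: perm_inj.
rewrite (negPf (notinB _ aps)) odd_mul_tperm ab /= signrN scaleNr.
congr (- (_ *: x_ _)); rewrite imsetU1 permM tpermR sa; congr (_ |: _).
apply: eq_in_imset => e eB; rewrite permM tpermD //.
  by apply: contraNneq (notinB a aps) => ->.
by apply: contraNneq (notinB b bps) => ->.
Qed.

End PairStab.

Section TwoRows.
Variables (F : fieldType) (m k : nat).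
Hypothesis km : (2 * k <= m)%N.
Local Notation shape := [:: (m - k)%N; k].
Local Notation x_ := (@gmon F m).
Implicit Types (t s : 'S_m).

Lemma cell_rowE (p : 'I_m) : cell_row shape p = (m - k <= p)%N.
Proof.
rewrite /cell_row /reshape_index /=; have := ltn_ord p.
by case: (leqP (m - k) p) => h1 h2 /=; rewrite ?addn0; do ?case: eqP => //=; lia.
Qed.

Lemma cell_colE (p : 'I_m) :
  cell_col shape p = if (m - k <= p)%N then (p - (m - k))%N else p.
Proof.
have := cell_rowE p; rewrite /cell_row /cell_col /reshape_offset => ->.
by case: leqP => _ /=; rewrite ?addn0 ?subn0.
Qed.

Fact top_cell_subproof (i : 'I_k) : (i < m)%N.
Proof. have := ltn_ord i; lia. Qed.
Fact bottom_cell_subproof (i : 'I_k) : (m - k + i < m)%N.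
Proof. have := ltn_ord i; lia. Qed.
(** The two-entry columns of the diagram (m-k, k) are the first k: column i
    consists of the cells i and m - k + i. *)
Definition top_cell (i : 'I_k) : 'I_m := Ordinal (top_cell_subproof i).
Definition bottom_cell (i : 'I_k) : 'I_m := Ordinal (bottom_cell_subproof i).

Definition column_pairs t : seq ('I_m * 'I_m) :=
  [seq (t (top_cell i), t (bottom_cell i)) | i <- enum 'I_k].

Lemma size_column_pairs t : size (column_pairs t) = k.
Proof. by rewrite size_map size_enum_ord. Qed.

Lemma mem_column_pairs t e f : (e, f) \in column_pairs t =
  [exists i, (e == t (top_cell i)) && (f == t (bottom_cell i))].
Proof.
apply/mapP/existsP => [[i _ [-> ->]]|[i /andP[/eqP-> /eqP->]]].
  by exists i; rewrite !eqxx.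
by exists i; rewrite ?mem_enum.
Qed.

Lemma col_stab_pairs t : col_stab shape t = pair_stab (column_pairs t).
Proof.
apply/setP => s; rewrite !inE; apply: eq_forallb => a.
rewrite /col_of !cell_colE /pair_rel !mem_column_pairs.
set p := (t^-1)%g a; set q := (t^-1)%g (s a).
have tp : a = t p by rewrite permKV.
have tq : s a = t q by rewrite permKV.
rewrite tq tp (inj_eq perm_inj).
have memE (x y : 'I_m) :
    [exists i, (t x == t (top_cell i)) && (t y == t (bottom_cell i))] =
    (x < k)%N && (y == m - k + x :> nat)%N.
  apply/existsP/andP => [[i h]|[xk /eqP yx]].
    move: h; rewrite !(inj_eq perm_inj) => /andP[/eqP -> /eqP ->] /=.
    by rewrite ltn_ord eqxx.
  by exists (Ordinal xk); rewrite !(inj_eq perm_inj) -!val_eqE /= yx !eqxx.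
rewrite !memE -val_eqE /=; have := ltn_ord p; have := ltn_ord q.
by case: ifP; case: ifP; lia.
Qed.

Lemma uniq_column_pairs t : uniq (pair_entries (column_pairs t)).
Proof.
have top_inj : injective (t \o top_cell).
  by move=> i j /perm_inj/(congr1 val) /= ij; apply: val_inj.
have bottom_inj : injective (t \o bottom_cell).
  by move=> i j /perm_inj/(congr1 val) /= /addnI ij; apply: val_inj.
rewrite (perm_uniq (perm_pair_entries _)) /unzip1 /unzip2.
rewrite -!(map_comp _ _ (enum 'I_k)) cat_uniq.
rewrite (map_inj_uniq top_inj) (map_inj_uniq bottom_inj) enum_uniq andbT.
apply/hasPn => _ /mapP[i _ ->]; apply/negP => /mapP[j _ /perm_inj/(congr1 val)] /=.
by have := ltn_ord j; lia.
Qed.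

(** Fill the diagram with the first entries of the pairs, then the unused
    elements, then the second entries. *)
Lemma column_pairs_surj (ps : seq ('I_m * 'I_m)) :
  size ps = k -> uniq (pair_entries ps) -> exists t, column_pairs t = ps.
Proof.
move=> sps ups; pose rest := [seq e <- enum 'I_m | e \notin pair_entries ps].
pose L := unzip1 ps ++ rest ++ unzip2 ps.
have pL : perm_eq L (pair_entries ps ++ rest).
  rewrite /L perm_catCA perm_sym perm_catC perm_cat2l.
  by rewrite perm_pair_entries.
have uL : uniq L.
  rewrite (perm_uniq pL) cat_uniq ups filter_uniq ?enum_uniq // andbT.
  by apply/hasPn => e; rewrite mem_filter => /andP[].
have sL : size L = m.
  rewrite -[RHS](size_enum_ord m); apply/perm_size/uniq_perm => //.
    exact: enum_uniq.
  move=> e; rewrite (perm_mem pL) mem_cat mem_filter mem_enum andbT.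
  by rewrite orbN.
(* The default value p of nth is never reached, and varies with p. *)
have L_inj : injective (fun p : 'I_m => nth p L p).
  move=> p q; rewrite (set_nth_default q) ?sL // => /eqP.
  by rewrite nth_uniq ?sL // => /eqP/val_inj.
have srest : size rest = (m - 2 * k)%N.
  have := perm_size pL; rewrite sL size_cat size_pair_entries sps; lia.
exists (perm L_inj).
have s1 : size (unzip1 ps) = k by rewrite size_map.
have nth1 (i : 'I_k) (x : 'I_m * 'I_m) : perm L_inj (top_cell i) = (nth x ps i).1.
  by rewrite permE /L nth_cat s1 /= ltn_ord (nth_map x) ?sps.
have nth2 (i : 'I_k) (x : 'I_m * 'I_m) : perm L_inj (bottom_cell i) = (nth x ps i).2.
  rewrite permE /L !nth_cat s1 srest /=; have ik := ltn_ord i.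
  rewrite ifN; last by lia.
  rewrite ifN; last by lia.
  rewrite (_ : (_ - _ - _)%N = i) ?(nth_map x) ?sps //; lia.
move: (perm L_inj) nth1 nth2 => t nth1 nth2.
case: ps {uL pL sL L_inj rest srest L ups s1} nth1 nth2 sps => [|x ps'] nth1 nth2 sps.
  by apply/eqP; rewrite -size_eq0 size_column_pairs -sps.
apply: (@eq_from_nth _ x) => [|i]; first by rewrite size_column_pairs.
rewrite size_column_pairs => ik.
rewrite (nth_map (Ordinal ik)) ?size_enum_ord // (nth_ord_enum _ (Ordinal ik)).
by rewrite (nth1 _ x) (nth2 _ x) -surjective_pairing.
Qed.

End TwoRows.

(** * From tabloids to monomials *)

Section Theta.
Variables (F : fieldType) (m k : nat).
Hypothesis km : (2 * k <= m)%N.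
Local Notation shape := [:: (m - k)%N; k].
Local Notation x_ := (@gmon F m).
Local Notation P := (perm_module F m shape).
Implicit Types (t s : 'S_m) (T : tabloid m shape).

Definition bottom_row T : {set 'I_m} :=
  [set a | row_of shape (tabloid_repr T) a == 1%N].

Lemma row_of_tabloid t a :
  row_of shape (tabloid_repr (tabloid_of shape t)) a = row_of shape t a.
Proof. by apply/tabloid_eqP; rewrite tabloid_reprK. Qed.

Lemma bottom_row_of t :
  bottom_row (tabloid_of shape t) = [set a | row_of shape t a == 1%N].
Proof. by apply/setP => a; rewrite !inE row_of_tabloid. Qed.

Lemma bottom_row_inj : injective bottom_row.
Proof.
move=> T T' /setP TT'; rewrite -[T]tabloid_reprK -[T']tabloid_reprK.
apply/eqP/tabloid_eqP => a; have := TT' a; rewrite !inE /row_of !cell_rowE //.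
by do 2!case: (_ <= _)%N.
Qed.

Lemma bottom_row_act s T : bottom_row (tabloid_act s T) = s @: bottom_row T.
Proof.
rewrite -[T]tabloid_reprK tabloid_actE !bottom_row_of; apply/setP => a.
rewrite -[a in RHS](permKV s) mem_imset; last exact: perm_inj.
by rewrite !inE row_ofM.
Qed.

Lemma bottom_row_column_pairs t :
  bottom_row (tabloid_of shape t) = [set e in unzip2 (column_pairs km t)].
Proof.
rewrite bottom_row_of; apply/setP => a; rewrite !inE /row_of cell_rowE //.
rewrite /unzip2 -(map_comp _ _ (enum 'I_k)).
apply/idP/mapP => [h|[i _ ->]]; last by rewrite /= permK /= leq_addr.
have ap : ((t^-1)%g a - (m - k) < k)%N by have := ltn_ord ((t^-1)%g a); lia.
exists (Ordinal ap); first by rewrite mem_enum.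
rewrite /= -[a in LHS](permKV t); congr (t _); apply: val_inj => /=.
by rewrite subnKC //; move: h; case: leqP.
Qed.

Definition tabloid_monomial_fun (f : P) : galg F m :=
  \sum_T (f T : F) *: x_ (bottom_row T).

Fact tabloid_monomial_linear : linear tabloid_monomial_fun.
Proof.
move=> c f g; rewrite /tabloid_monomial_fun scaler_sumr -big_split.
by apply: eq_bigr => T _; rewrite !ffunE scalerDl scalerA.
Qed.
HB.instance Definition _ := GRing.isLinear.Build F P (galg F m) _
  tabloid_monomial_fun tabloid_monomial_linear.

Definition tabloid_monomial : 'Hom(P, galg F m) := linfun tabloid_monomial_fun.
Local Notation theta := tabloid_monomial.

Lemma tabloid_monomialE f : theta f = \sum_T (f T : F) *: x_ (bottom_row T).
Proof. exact: lfunE. Qed.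

Lemma tabloid_monomial_vec T : theta (tabloid_vec F T) = x_ (bottom_row T).
Proof.
rewrite tabloid_monomialE (bigD1 T) //= ffunE eqxx scale1r.
by rewrite big1 ?addr0 // => U /negPf h; rewrite ffunE h scale0r.
Qed.

Lemma gcoord_sumE (I : finType) (c : I -> F) (a : I -> galg F m) S :
  gcoord (\sum_i c i *: a i) S = \sum_i c i * gcoord (a i) S.
Proof.
elim/big_rec2: _ => [|i x v _ <-]; last by rewrite gcoordP.
by rewrite -(addNr (0 : galg F m)) -scaleN1r gcoordP mulN1r addNr.
Qed.

Lemma tabloid_monomial_inj : injective theta.
Proof.
move=> f g fg; apply/ffunP => T.
have c h : gcoord (theta h) (bottom_row T) = h T.
  rewrite tabloid_monomialE.
  rewrite (@gcoord_sumE _ (fun U => h U) (fun U => x_ (bottom_row U))).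
  transitivity (\sum_U (h U : F) * (U == T)%:R).
    apply: eq_bigr => U _; congr (_ * _); apply: etrans (gcoord_gmon _ _ _) _.
    by rewrite (inj_eq bottom_row_inj) eq_sym.
  rewrite (bigD1 T) //= eqxx mulr1 big1 ?addr0 // => U /negPf ->.
  exact: mulr0.
by rewrite -c fg c.
Qed.

Lemma tabloid_vec_sum (f : P) : f = \sum_T f T *: tabloid_vec F T.
Proof.
apply/ffunP => U; rewrite sum_ffunE.
transitivity (\sum_T (f T : F) * (U == T)%:R).
  rewrite (bigD1 U) //= eqxx mulr1 big1 ?addr0 // => T; rewrite eq_sym => /negPf ->.
  exact: mulr0.
apply: eq_bigr => T _.
by rewrite !ffunE.
Qed.

Lemma tabloid_monomial_act s f :
  Defs.gact F s (theta f) = theta (@perm_module_act F m shape s f).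
Proof.
rewrite [f]tabloid_vec_sum !linear_sum; apply: eq_bigr => T _.
rewrite !linearZ /=; congr (_ *: _).
rewrite perm_module_actE [RHS]tabloid_monomial_vec bottom_row_act -gactE.
by congr (Defs.gact F s _); apply: tabloid_monomial_vec.
Qed.

Lemma tabloid_monomial_polytabloid t :
  theta (polytabloid F shape t) = pairprod F (column_pairs km t).
Proof.
rewrite pairprod_signed_sum ?uniq_column_pairs // /polytabloid linear_sum.
rewrite (col_stab_pairs km); apply: eq_bigr => s _; rewrite linearZ /=.
rewrite tabloid_monomial_vec -tabloid_actE bottom_row_act.
by rewrite bottom_row_column_pairs.
Qed.

Hypothesis pchar0 : [pchar F] =i pred0.

(** Polytabloids are mapped exactly onto the products of k differences, which
    span the kernel of D_- in degree k. *)
Lemma tabloid_monomial_specht v :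
  v \in (theta @: specht F m shape)%VS <->
  of_degree k v /\ gD_minus F m v = 0.
Proof.
split=> [|[kv Dv]].
  suff /subvP/[apply] : (theta @: specht F m shape <= pairspan F k [set: 'I_m])%VS.
    by case/pairspan_sub.
  rewrite limg_span; apply/span_subvP => _ /mapP[_ /codomP[t ->] ->].
  rewrite tabloid_monomial_polytabloid -[in pairspan _ k](size_column_pairs km t).
  apply: mem_pairspan; rewrite /pair_family uniq_column_pairs.
  by apply/allP => e; rewrite inE.
apply: (subvP (_ : pairspan F k [set: 'I_m] <= _)%VS); last first.
  by apply: ker_gD_minus_span => // e; rewrite inE.
apply: pairspan_ind => ps sps /andP[ups _].
have [t <-] := column_pairs_surj km sps ups.
rewrite -tabloid_monomial_polytabloid; apply/memv_img/memv_span/codom_f.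
Qed.

End Theta.

(** * Invariants of the graph algebra *)

Section Submodule.
Variables (F : fieldType) (M : sl2Module F) (U : {vspace M}).
Hypothesis stabU : forall x, (sl2_rho M x @: U <= U)%VS.

Lemma sl2_sub_rhoE x u :
  vsval (sl2_rho (sl2_sub stabU) x u) = sl2_rho M x (vsval u).
Proof.
have -> : sl2_rho (sl2_sub stabU) x = sl2_sub_act U x by exact: lfunE.
exact: sl2_sub_actE.
Qed.

End Submodule.

Section Decomposition.
Variables (F : fieldType) (m : nat) (G : {set 'S_m}).
Hypothesis pchar0 : [pchar F] =i pred0.
Local Notation A := (galg F m).
Local Notation x_ := (@gmon F m).
Local Notation AG := (sl2_galg_inv F G).
Local Notation shape k := [:: (m - k)%N; k].

Let natr_eq0 n : (n%:R == 0 :> F) = (n == 0%N).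
Proof. exact: (pcharf0P F).1. Qed.

Definition homog_part j : 'End(A) :=
  glin (fun S => if #|S| == j then x_ S else 0).

Lemma homog_part_degree j v : of_degree j (homog_part j v).
Proof.
rewrite /of_degree -scale_lfunE -comp_lfunE.
apply: eq_galg => S; rewrite scale_lfunE comp_lfunE glinE.
by case: eqP => [<-|_]; rewrite ?gdegreeE // scaler0 linear0.
Qed.

Lemma homog_part_sum v : v = \sum_(0 <= j < m.+1) homog_part j v.
Proof.
rewrite big_mkord -sum_lfunE -{1}[v]id_lfunE; apply: eq_galg => S.
have Sm : (#|S| < m.+1)%N by rewrite ltnS -[X in (_ <= X)%N]card_ord max_card.
rewrite id_lfunE sum_lfunE (bigD1 (Ordinal Sm)) //= glinE eqxx.
rewrite big1 ?addr0 // => j jS; rewrite glinE ifN //.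
by apply: contraNneq jS => Sj; apply/eqP/val_inj.
Qed.

Lemma homog_part_act j s v :
  Defs.gact F s (homog_part j v) = homog_part j (Defs.gact F s v).
Proof.
rewrite -!comp_lfunE; apply: eq_galg => S; rewrite !comp_lfunE gactE !glinE.
rewrite card_imset; last exact: perm_inj.
by case: eqP => _; rewrite ?linear0 ?gactE.
Qed.

Lemma galg_triple :
  [/\ sl2_rho (sl2_galg F m) (sl2_e_plus F) = gD_plus F m,
      sl2_rho (sl2_galg F m) (sl2_e_minus F) = gD_minus F m &
      sl2_rho (sl2_galg F m) (sl2_h F) = gD_zero F m].
Proof. exact: sl2_of_tripleE. Qed.

Lemma has_weight_degree j (v : AG) :
  @has_weight F AG m j v <-> of_degree j (vsval v).
Proof.
have [_ _ hE] := galg_triple.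
have key : vsval (sl2_rho AG (sl2_h F) v) =
    2%:R *: gdegree F m (vsval v) - m%:R *: vsval v.
  by rewrite sl2_sub_rhoE hE gD_zero_degree.
split=> [vj|vj].
  have two0 : 2%:R != 0 :> F by rewrite natr_eq0.
  apply: (scalerI two0); apply: (addIr (- (m%:R *: vsval v))).
  by rewrite -key vj linearZ /= /weight scalerBl scalerA.
by apply: val_inj; rewrite /= key vj /weight scalerBl scalerA.
Qed.

Lemma lowest_degree j (v : AG) : @lowest F AG m j v <->
  of_degree j (vsval v) /\ gD_minus F m (vsval v) = 0.
Proof.
have [_ dE _] := galg_triple.
have key : vsval (sl2_rho AG (sl2_e_minus F) v) = gD_minus F m (vsval v).
  by rewrite sl2_sub_rhoE dE.
split=> [[Dv /has_weight_degree vj]|[vj Dv]].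
  by split=> //; rewrite -key Dv linear0.
split; last exact/has_weight_degree.
by apply: val_inj; rewrite /= key Dv.
Qed.

(** The homogeneous parts of an invariant are invariant, since permutations
    preserve degrees. *)
Lemma galg_inv_weights (v : AG) : exists2 u : nat -> AG,
  forall j, @has_weight F AG m j (u j) & v = \sum_(0 <= j < m.+1) u j.
Proof.
have uG j : homog_part j (vsval v) \in galg_inv F G.
  apply/invariantsP; split=> [|g gG]; first exact: memvf.
  rewrite homog_part_act; congr (homog_part j _).
  by have /invariantsP[_] := subvsP v; apply.
exists (fun j => vsproj (galg_inv F G) (homog_part j (vsval v))) => [j|].
  by apply/has_weight_degree; rewrite vsprojK //; apply: homog_part_degree.
apply: val_inj; rewrite /= linear_sum {1}[vsval v]homog_part_sum.
by apply: eq_bigr => j _; rewrite /= vsprojK.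
Qed.

Section Embedding.
Variable k : nat.
Hypothesis km : (2 * k <= m)%N.
Local Notation theta := (tabloid_monomial F m k).

Definition specht_embed : 'Hom(subvs_of (specht_inv F G (shape k)), AG) :=
  (linfun (vsproj (galg_inv F G)) \o theta \o linfun vsval)%VF.

Lemma specht_embedE w : vsval (specht_embed w) = theta (vsval w).
Proof.
rewrite !comp_lfunE [linfun vsval w]lfunE [X in vsval X]lfunE /=.
rewrite vsprojK //; apply/invariantsP.
split=> [|g gG]; first exact: memvf.
have /invariantsP[_ /(_ g gG) gw] := subvsP w.
by apply: etrans (tabloid_monomial_act g _) _; congr (theta _).
Qed.

Lemma specht_embed_inj : injective specht_embed.
Proof.
move=> u w /(congr1 vsval); rewrite !specht_embedE.
by move/(tabloid_monomial_inj km)/val_inj.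
Qed.

Lemma specht_embedP v : v \in limg specht_embed <-> @lowest F AG m k v.
Proof.
split=> [/memv_imgP[w _ ->]|/lowest_degree/(tabloid_monomial_specht km pchar0)].
  apply/lowest_degree; rewrite specht_embedE.
  apply/(tabloid_monomial_specht km pchar0)/memv_img.
  by have /invariantsP[] := subvsP w.
move=> /memv_imgP[w wS vw].
have wG : w \in specht_inv F G (shape k).
  apply/invariantsP; split=> // g gG; apply: (tabloid_monomial_inj km).
  apply: etrans (esym (tabloid_monomial_act g w)) _; rewrite -vw.
  by have /invariantsP[_] := subvsP v; apply.
have -> : v = specht_embed (vsproj _ w).
  by apply: val_inj; rewrite /= specht_embedE vsprojK.
exact/memv_img/memvf.
Qed.

End Embedding.

Theorem galg_inv_decomposition :
  sl2_isomorphic AG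
    (\big[@sl2_sum F / sl2_zero F]_(0 <= k < (m %/ 2).+1)
       sl2_tensor (subvs_of (specht_inv F G (shape k))) (sl2_irr F (m - 2 * k)%N)).
Proof.
apply: (@weight_module_decomp F AG m pchar0 galg_inv_weights
  (fun k => subvs_of (specht_inv F G (shape k))) specht_embed).
  exact: specht_embed_inj.
exact: specht_embedP.
Qed.

End Decomposition.

Theorem mainTheorem15 (R : realType) (n : nat) :
  let m := 'C(n, 2) in
  let Gamma := pair_group n in
  sl2_isomorphic
    (sl2_galg_inv R[i] Gamma)
    (\big[@sl2_sum R[i] / sl2_zero R[i]]_(0 <= k < (m %/ 2).+1)
       sl2_tensor
         (subvs_of (specht_inv R[i] Gamma [:: (m - k)%N; k]))
         (sl2_irr R[i] (m - 2 * k)%N)).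
Proof.
move=> m Gamma; apply: galg_inv_decomposition.
exact: Num.Theory.pchar_num.
Qed.
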